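(* Let $T$ be a $k$-regular tree with $k\geq 3$, and let $\mu$ be the Haar measure on $\mathrm{Aut}(T)$ normalized so that vertex stabilizers have measure $1$. Let $\Gamma<\mathrm{Aut}(T)$ be a countable subgroup acting almost freely on $T$. Then for $\mu$-almost all elements $\gamma\in\mathrm{Aut}(T)$, the group $\langle\Gamma,\gamma\rangle$ acts almost freely on $T$ and is isomorphic to the free product $\Gamma*\mathbb{Z}$.
   Context: $\mathrm{Aut}(T)$ is the automorphism group of the tree $T$ with the topology of pointwise convergence; it is a locally compact, totally disconnected, unimodular topological group, and $\mu$ is an infinite measure. A subgroup $\Gamma\leq\mathrm{Aut}(T)$ acts almost freely if every $\gamma\in\Gamma$ with $\gamma\neq 1$ has finitely many fixed points (fixed vertices) on $T$; having none is allowed. *)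

(* Defs.v *)
From HB Require Import structures.
From mathcomp Require Import all_boot all_order all_algebra.
From mathcomp Require Import all_classical all_reals all_analysis.

Set Implicit Arguments.
Unset Strict Implicit.
Unset Printing Implicit Defensive.

Local Open Scope classical_set_scope.
Local Open Scope ring_scope.
Local Open Scope group_scope.

Section Trees.
Variables (V : choiceType) (e : rel V).

(* A graph is given by its adjacency relation e. *)
Definition simple_graph := symmetric e /\ irreflexive e.

Definition connected_graph :=
  forall x y : V, exists2 p : seq V, path e x p & last x p = y.

(* With the convention of ucycle, an edge {x, y} yields the closed walk
   [:: x; y], so the cycles of a simple graph are those of size at least 3. *)
Definition acyclic_graph := forall c : seq V, ucycle e c -> (size c < 3)%N.

Definition is_tree :=
  [/\ [set: V] !=set0, simple_graph, connected_graph & acyclic_graph].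

Definition regular_graph (k : nat) :=
  forall v : V, ([set w | e v w] #= `I_k)%card.

Definition is_aut (f : V -> V) :=
  bijective f /\ forall x y, e (f x) (f y) = e x y.

Record Aut := MkAut { aut_fun :> V -> V; _ : `[< is_aut aut_fun >] }.

HB.instance Definition _ := [isSub for aut_fun].
HB.instance Definition _ := [Choice of Aut by <:].

Lemma autP (g : Aut) : is_aut g.
Proof. exact/asboolP/(valP g). Qed.

Lemma aut_ext (g h : Aut) : g =1 h -> g = h.
Proof. by move=> gh; apply/val_inj/funext. Qed.

Lemma is_aut_id : is_aut id.
Proof. by split=> //; exists id. Qed.

Lemma is_aut_comp (g h : Aut) : is_aut (g \o h).
Proof.
have [gb ge] := autP g; have [hb he] := autP h.
by split=> [|x y]; [exact: bij_comp | rewrite /= ge he].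
Qed.

Lemma ex_aut_inv (g : Aut) :
  exists f : V -> V, [/\ cancel g f, cancel f g & is_aut f].
Proof.
have [[f gf fg] ge] := autP g; exists f; split=> //.
by split=> [|x y]; [exists g | rewrite -ge !fg].
Qed.

Definition aut_id := MkAut (asboolT is_aut_id).
Definition aut_comp g h := MkAut (asboolT (is_aut_comp g h)).
Definition aut_inv g : Aut :=
  let: exist _ (And3 _ _ f_aut) := cid (ex_aut_inv g) in MkAut (asboolT f_aut).

Lemma aut_compA : associative aut_comp.
Proof. by move=> f g h; apply: aut_ext. Qed.

Lemma aut_comp1g : left_id aut_id aut_comp.
Proof. by move=> g; apply: aut_ext. Qed.

Lemma aut_compg1 : right_id aut_id aut_comp.
Proof. by move=> g; apply: aut_ext. Qed.

Lemma aut_compVg : left_inverse aut_id aut_inv aut_comp.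
Proof.
move=> g; apply: aut_ext => x; rewrite /aut_comp /aut_inv /=.
by case: cid => f [gf fg ?] /=; rewrite gf.
Qed.

Lemma aut_compgV : right_inverse aut_id aut_inv aut_comp.
Proof.
move=> g; apply: aut_ext => x; rewrite /aut_comp /aut_inv /=.
by case: cid => f [gf fg ?] /=; rewrite fg.
Qed.

HB.instance Definition _ := isGroup.Build Aut
  aut_compA aut_comp1g aut_compg1 aut_compVg aut_compgV.

(* Pointwise convergence: the topology induced by the product topology on
   V -> V, where V is discrete. *)
Definition aut_ptws (g : Aut) : {ptws V -> discrete_topology V} := aut_fun g.

HB.instance Definition _ := Topological.copy Aut (initial_topology aut_ptws).
HB.instance Definition _ := isPointed.Build Aut aut_id.

Definition BorelAut := g_sigma_algebraType (@open Aut).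
HB.instance Definition _ := Measurable.on BorelAut.

(* Regularity is not required: Aut T is locally compact and second countable
   when T is a locally finite tree, so it is automatic. *)
Definition haar_measure (R : realType) (mu : {measure set BorelAut -> \bar R}) :=
  [/\ (mu setT != 0)%E,
      forall K : set Aut, compact K -> (mu K < +oo)%E &
      forall (g : Aut) (A : set BorelAut), measurable A ->
        mu [set g * h | h in A] = mu A].

Definition vertex_stabilizer (v : V) : set Aut := [set g | g v = v].

Definition acts_almost_freely (D : {pred Aut}) :=
  forall g : Aut, g \in D -> g != 1 -> finite_set [set v | g v = v].

End Trees.

Arguments vertex_stabilizer {V} e v.

Section Subgroups.
Variable G : groupType.

Definition subgroup_type (D : groupClosed G) : Type := {x : G | x \in D}.

Section SubgroupType.
Variable D : groupClosed G.

HB.instance Definition _ := SubChoice.on (subgroup_type D).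

Lemma subgroup_closed : group_closed (fun x : G => x \in D).
Proof. by split=> [|x y xD yD]; [exact: gpred1 | exact: gpredF]. Qed.

HB.instance Definition _ :=
  SubChoice_isSubGroup.Build G _ (subgroup_type D) subgroup_closed.
End SubgroupType.

Definition generated (A : set G) : {pred G} :=
  fun x => `[< forall D : groupClosed G, A `<=` [set` D] -> x \in D >].

Section Generated.
Variable A : set G.

Lemma generatedM : mulg_closed (generated A).
Proof.
move=> x y /asboolP xA /asboolP yA; apply/asboolP => D AD.
by apply: gpredM; [exact: xA | exact: yA].
Qed.

Lemma generated1 : 1 \in generated A.
Proof. by apply/asboolP => D _; exact: gpred1. Qed.

Lemma generatedV : invg_closed (generated A).
Proof.
by move=> x /asboolP xA; apply/asboolP => D AD; rewrite gpredV; exact: xA.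
Qed.

HB.instance Definition _ := isMulClosed.Build G (generated A) generatedM.
HB.instance Definition _ := isMul1Closed.Build G (generated A) generated1.
HB.instance Definition _ := isInvClosed.Build G (generated A) generatedV.
End Generated.

End Subgroups.

Definition isomorphic (G H : groupType) :=
  exists f : G -> H, bijective f /\ {morph f : x y / x * y}.

(* The free product G * H is the monoid of words over the disjoint union of G
   and H, modulo the smallest congruence that identifies the one-letter words
   1 with the empty word and multiplies adjacent letters of the same factor. *)
Section FreeProduct.
Local Open Scope quotient_scope.
Variables G H : groupType.

Definition fword : Type := seq (G + H).
HB.instance Definition _ := Choice.on fword.

Inductive fword_eq : fword -> fword -> Prop :=
| fword_refl u : fword_eq u u
| fword_sym u v : fword_eq u v -> fword_eq v u
| fword_trans u v w : fword_eq u v -> fword_eq v w -> fword_eq u w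
| fword_cat u u' v v' :
    fword_eq u u' -> fword_eq v v' -> fword_eq (u ++ v) (u' ++ v')
| fword_1l : fword_eq [:: inl 1] [::]
| fword_1r : fword_eq [:: inr 1] [::]
| fword_Ml a b : fword_eq [:: inl a; inl b] [:: inl (a * b)]
| fword_Mr a b : fword_eq [:: inr a; inr b] [:: inr (a * b)].

Definition fword_rel : rel fword := fun u v => `[< fword_eq u v >].

Lemma fword_rel_equiv : equiv_class_of fword_rel.
Proof.
split=> [u|u v|v u w].
- by apply/asboolP; constructor.
- by apply/asboolP/asboolP; exact: fword_sym.
- by move=> /asboolP uv /asboolP vw; apply/asboolP; exact: fword_trans vw.
Qed.

Canonical fword_equiv := EquivRelPack fword_rel_equiv.

Definition free_product : Type := {eq_quot fword_rel}.

HB.instance Definition _ := EqQuotient.on free_product.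
HB.instance Definition _ := Choice.on free_product.

Implicit Types x y z : free_product.

Definition fp_mul x y : free_product := \pi_free_product (repr x ++ repr y).
Definition fp_one : free_product := \pi_free_product ([::]).

Definition letter_inv (l : G + H) : G + H :=
  match l with inl a => inl a^-1 | inr b => inr b^-1 end.
Definition fword_inv (u : fword) : fword := rev (map letter_inv u).
Definition fp_inv x : free_product := \pi_free_product (fword_inv (repr x)).

Lemma fp_piP (u v : fword) :
  (\pi_free_product u = \pi_free_product v) <-> fword_eq u v.
Proof. by split=> [/eqquotP/asboolP|uv] //; apply/eqquotP/asboolP. Qed.

Lemma fword_repr (u : fword) : fword_eq (repr (\pi_free_product u)) u.
Proof. by apply/fp_piP; rewrite reprK. Qed.

Lemma fp_mul_pi (u v : fword) :
  fp_mul (\pi_free_product u) (\pi_free_product v) = \pi_free_product (u ++ v).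
Proof. by apply/fp_piP/fword_cat; exact: fword_repr. Qed.

Lemma fp_mulA : associative fp_mul.
Proof.
elim/quotW=> u; elim/quotW=> v; elim/quotW=> w.
by rewrite (fp_mul_pi v w) (fp_mul_pi u v) !fp_mul_pi catA.
Qed.

Lemma fp_mul1g : left_id fp_one fp_mul.
Proof. by elim/quotW=> u; rewrite fp_mul_pi. Qed.

Lemma fp_mulg1 : right_id fp_one fp_mul.
Proof. by elim/quotW=> u; rewrite fp_mul_pi cats0. Qed.

Lemma letter_invK : involutive letter_inv.
Proof. by case=> a /=; rewrite invgK. Qed.

Lemma fword_invK : involutive fword_inv.
Proof. by move=> u; rewrite /fword_inv map_rev revK (mapK letter_invK). Qed.

Lemma letter_mulV l : fword_eq [:: l; letter_inv l] [::].
Proof.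
case: l => a /=.
- by apply: (fword_trans (fword_Ml _ _)); rewrite mulgV; exact: fword_1l.
- by apply: (fword_trans (fword_Mr _ _)); rewrite mulgV; exact: fword_1r.
Qed.

Lemma fword_mulV u : fword_eq (u ++ fword_inv u) [::].
Proof.
elim: u => [|l u IHu]; first exact: fword_refl.
have -> : (l :: u) ++ fword_inv (l :: u) =
    [:: l] ++ ((u ++ fword_inv u) ++ [:: letter_inv l]).
  by rewrite /fword_inv /= rev_cons -cats1 catA.
apply: fword_trans (letter_mulV l).
apply: (@fword_cat [:: l] [:: l]); first exact: fword_refl.
apply: (@fword_cat _ [::] [:: letter_inv l]) => //; exact: fword_refl.
Qed.

Lemma fword_inv_eq u v : fword_eq u v -> fword_eq (fword_inv u) (fword_inv v).
Proof.
move=> uv; rewrite -[fword_inv u]cats0 -[fword_inv v]cat0s.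
apply: (@fword_trans _ (fword_inv u ++ (v ++ fword_inv v))).
  by apply: fword_cat; [exact: fword_refl | exact/fword_sym/fword_mulV].
rewrite catA; apply: fword_cat; last exact: fword_refl.
apply: (@fword_trans _ (fword_inv u ++ u)).
  by apply: fword_cat; [exact: fword_refl | exact: fword_sym].
by have := fword_mulV (fword_inv u); rewrite fword_invK.
Qed.

Lemma fp_inv_pi u : fp_inv (\pi_free_product u) = \pi_free_product (fword_inv u).
Proof. by apply/fp_piP/fword_inv_eq; exact: fword_repr. Qed.

Lemma fp_mulVg : left_inverse fp_one fp_inv fp_mul.
Proof.
elim/quotW=> u; rewrite fp_inv_pi fp_mul_pi; apply/fp_piP.
by have := fword_mulV (fword_inv u); rewrite fword_invK.
Qed.

Lemma fp_mulgV : right_inverse fp_one fp_inv fp_mul.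
Proof.
elim/quotW=> u; rewrite fp_inv_pi fp_mul_pi; apply/fp_piP.
exact: fword_mulV.
Qed.

HB.instance Definition _ := isGroup.Build free_product
  fp_mulA fp_mul1g fp_mulg1 fp_mulVg fp_mulgV.

End FreeProduct.

(* Main.v *)
(* Fix a reduced word w in t and Gamma, with t occurring; it suffices to show
   that for almost every g the automorphism w(g) has finitely many fixed
   vertices: countably many words then make <Gamma, g> act almost freely, and
   make the map from Gamma * Z injective because T is infinite.  By induction
   on the number of occurrences of t the shorter words are settled; hence,
   outside a finite set of vertices v, the vertices at which g gets applied
   while w(g) v is computed are pairwise distinct (two equal ones give a fixed
   vertex of a shorter word, or of an element of Gamma).

   Suppose that w(g) fixes o, and reveal g one star at a time.  Given g on the
   closed neighbourhood of a finite subtree I, its value on the children of a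
   leaf x is a uniformly distributed bijection, by left invariance of the Haar
   measure.  Call a fixed vertex active if its trajectory is known but has
   left I.  When the last missing star on the trajectory of an active vertex v
   is revealed, v is replaced by its fixed children, and each of its k - 1
   children is fixed with probability 1/(k - 1): the number A of active
   vertices is a supermartingale.  If w(g) has infinitely many fixed vertices,
   then A never vanishes.

   Let theta be the supremum of P(survival | revealed part) / A.  Near a
   maximizing configuration A behaves as a martingale for as many steps as we
   like, while A <= 1/theta approximately.  But A can always be made to grow:
   reveal all of the trajectory of v except one leaf x, then let all the
   children of v be fixed.  If this changes A, then some outcome increases A.
   Otherwise as many vertices are born as were resolved at x, and one child of
   v does not go through the new leaf of another: repeat with that leaf, which
   fewer active vertices share than x.  So theta = 0. *)
From HB Require Import structures.
Require Import Defs.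
From mathcomp Require Import all_boot all_order all_algebra perm finmap.
From mathcomp Require Import ring lra.
From mathcomp Require Import all_classical all_reals all_analysis.

Set Implicit Arguments.
Unset Strict Implicit.
Unset Printing Implicit Defensive.

Import Order.TTheory GRing.Theory Num.Theory.

Local Open Scope classical_set_scope.
Local Open Scope ring_scope.
Local Open Scope nat_scope.

(** * Rooted trees and their automorphisms *)

Section Rooting.
Variables (V : choiceType) (e : rel V).

(** Making the root its own parent lets [par] be iterated forever; [u != v] removes the loop that
    this creates at [o]. *)
Definition rooting (o : V) (par : V -> V) (dep : V -> nat) :=
  [/\ par o = o, dep o = 0, forall v, v != o -> dep v = (dep (par v)).+1 &
      forall u v, e u v = (u != v) && ((par u == v) || (par v == u))].

Lemma ex_dist (o : V) : connected_graph e ->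
  exists d : V -> nat, [/\ d o = 0, forall v, d v = 0 -> v = o,
    forall u v, e u v -> d v <= (d u).+1 &
    forall v n, d v = n.+1 -> exists2 u, e u v & d u = n].
Proof.
move=> conn.
pose P v n := `[< exists2 p, path e o p /\ last o p = v & size p = n >].
have exP v : exists n, P v n.
  by have [p pp lp] := conn o v; exists (size p); apply/asboolP; exists p.
pose d v := ex_minn (exP v).
have dP v : P v (d v) by rewrite /d; case: ex_minnP.
have dmin v n : P v n -> d v <= n by rewrite /d; case: ex_minnP => m _ h /h.
have dE u v : e u v -> d v <= (d u).+1.
  move=> uv; apply: dmin; have /asboolP[p [pp lp] sp] := dP u.
  by apply/asboolP; exists (rcons p v); rewrite ?rcons_path ?pp ?lp ?last_rcons ?size_rcons ?sp.
exists d; split => //.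
- by apply/eqP; rewrite -leqn0; apply: dmin; apply/asboolP; exists [::].
- by by move=> v d0; have /asboolP[p [_ lp]] := dP v; rewrite d0 -lp => /size0nil ->.
- move=> v n dv; have /asboolP[p [pp lp]] := dP v; rewrite dv.
  elim/last_ind: p pp lp => // p x _; rewrite rcons_path last_rcons size_rcons.
  move=> /andP[pp ex] xv [sp]; rewrite {}xv in ex.
  exists (last o p) => //; apply/eqP; rewrite eqn_leq.
  have -> : d (last o p) <= n by apply: dmin; apply/asboolP; exists p.
  by rewrite -ltnS -dv dE.
Qed.

Lemma ex_rooting (o : V) : is_tree e -> exists par dep, rooting o par dep.
Proof.
move=> [_ [esy eirr] conn acyc].
have [d [d0 d0o dle dpred]] := ex_dist o conn.
have : forall v, exists u, if v == o then u = o else e u v /\ d v = (d u).+1.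
  move=> v; case: (eqVneq v o) => [_|vo]; first by exists o.
  case E: (d v) => [|n]; first by rewrite (d0o _ E) eqxx in vo.
  by have [u uv du] := dpred _ _ E; exists u; rewrite du.
move=> /choice[par parP].
have par0 : par o = o by have := parP o; rewrite eqxx.
have parE v : v != o -> e (par v) v by move=> /negPf h; have := parP v; rewrite h => -[].
have pard v : v != o -> d v = (d (par v)).+1.
  by move=> /negPf h; have := parP v; rewrite h => -[].
(* Two neighbours of equal depth, or two neighbours of the same vertex one
   level up, would close such a path up to a cycle. *)
have join n : forall u u', u != u' -> d u = n -> d u' = n ->
    exists p, [/\ path e u (rcons p u'), uniq (u :: rcons p u'), p != [::]
      & all (fun x => d x <= n) p].
  elim: n => [|n IH] u u' uu' du du'.
    by move: uu'; rewrite (d0o _ du) (d0o _ du') eqxx.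
  have uo : u != o by apply: contra_eq_neq du => ->; rewrite d0.
  have u'o : u' != o by apply: contra_eq_neq du' => ->; rewrite d0.
  have := pard _ uo; rewrite du => -[] /esym dpu.
  have := pard _ u'o; rewrite du' => -[] /esym dpu'.
  have neqd x y : d x = n -> d y = n.+1 -> x != y.
    by move=> dx dy; apply: contra_eq_neq dx => ->; rewrite dy; elim: (n).
  have [pe|pne] := eqVneq (par u) (par u').
    exists [:: par u]; split => //=.
    - by rewrite esy parE //= pe parE.
    - by rewrite !inE negb_or uu' (neqd _ _ dpu du') (eq_sym u) (neqd _ _ dpu du).
    - by rewrite dpu leqnSn.
  have [p [pp up pn pd]] := IH _ _ pne dpu dpu'.
  have pd' : all (fun x => d x <= n) (par u :: rcons p (par u')).
    by rewrite /= all_rcons dpu dpu' leqnn.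
  exists (par u :: rcons p (par u')); split => //.
  - by rewrite rcons_path /= esy parE //= pp last_rcons parE.
  - rewrite rcons_cons cons_uniq -rcons_cons rcons_uniq up andbT mem_rcons in_cons.
    rewrite negb_or uu' /=.
    by apply/andP; split; apply/negP => /(allP pd'); rewrite ?du ?du' ltnn.
  - by apply: sub_all pd' => x /leq_trans; apply.
have noclose (u u' : V) (p : seq V) : path e u (rcons p u') -> uniq (u :: rcons p u') ->
    p != [::] -> e u' u -> False.
  move=> pp up pn u'u.
  have : ucycle e (u :: rcons p u').
    by rewrite /ucycle up andbT /= rcons_path pp last_rcons.
  by move=> /acyc; rewrite /= size_rcons; case: p pn {pp up}.
exists par, d; split => // u v; apply/idP/idP; last first.
  case/andP=> uv /orP[/eqP pu|/eqP pv].
  - by rewrite esy -pu parE //; apply: contra_neq uv => uo; rewrite -pu uo par0.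
  - by rewrite -pv parE //; apply: contra_neq uv => vo; rewrite -pv vo par0.
move=> uv; have uNv : u != v by apply: contraTneq uv => ->; rewrite eirr.
rewrite uNv /=.
(* Otherwise the path from [par y] to [x] stays at depth at most [d x], so it misses [y], and [y]
   closes it to a cycle. *)
have key x y : e x y -> d y = (d x).+1 -> par y = x.
  move=> xy dy; apply/eqP; apply/negPn/negP => px.
  have yo : y != o by apply: contra_eq_neq dy => ->; rewrite d0.
  have := pard _ yo; rewrite dy => -[] /esym dpy.
  have [p [pp up pn pd]] := join _ _ _ px dpy erefl.
  have yp : y \notin par y :: rcons p x.
    rewrite inE mem_rcons inE !negb_or; apply/and3P; split.
    - by apply: contra_eq_neq dpy => <-; rewrite dy; elim: (d x).
    - by apply: contra_eq_neq dy => ->; elim: (d x).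
    - by apply/negP => /(allP pd); rewrite dy ltnn.
  apply: (@noclose y x (par y :: p)) => //.
  - by rewrite /= esy parE.
  - by rewrite rcons_cons cons_uniq yp.
have := dle _ _ uv; have := dle v u; rewrite esy uv => /(_ isT).
have [duv|duv|duv] := ltngtP (d u) (d v).
- move=> _ le1; have -> : par v = u by apply: key => //; apply/eqP; rewrite eqn_leq le1.
  by rewrite eqxx orbT.
- move=> le1 _; have -> : par u = v by apply: key; rewrite 1?esy//; apply/eqP; rewrite eqn_leq le1.
  by rewrite eqxx.
- move=> _ _; have [p [pp up pn pd]] := join _ _ _ uNv duv erefl.
  by case: (noclose _ _ _ pp up pn); rewrite esy.
Qed.

End Rooting.

Section Neighbours.
Variables (V : choiceType) (e : rel V) (k : nat).

Definition neighbours (nb : V -> seq V) :=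
  forall v, [/\ uniq (nb v), size (nb v) = k & forall w, (w \in nb v) = e v w].

Lemma ex_neighbours : regular_graph e k -> exists nb, neighbours nb.
Proof.
move=> reg; suff /choice[nb nbP] : forall v, exists s : seq V,
    [/\ uniq s, size s = k & forall w, (w \in s) = e v w] by exists nb.
move=> v; have fin : finite_set [set w | e v w] by exists k; exact: reg.
exists (enum_fset (fset_set [set w | e v w])); split => //.
- by apply: card_fset_set; exact: reg.
- by move=> w; rewrite in_fset_set //; apply/idP/idP; rewrite inE.
Qed.

End Neighbours.

Section RootedTree.
Variables (V : choiceType) (e : rel V) (k : nat).
Variables (o : V) (par : V -> V) (dep : V -> nat).
Hypothesis rootP : rooting e o par dep.
Variable nb : V -> seq V.
Hypothesis nbP : neighbours e k nb.

Definition children v := [seq w <- nb v | w != par v].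

Lemma par_root : par o = o. Proof. by case: rootP. Qed.

Lemma dep_par v : v != o -> dep v = (dep (par v)).+1.
Proof. by case: rootP => _ _ + _; apply. Qed.

Lemma rooted_adj u v : e u v = (u != v) && ((par u == v) || (par v == u)).
Proof. by case: rootP. Qed.

Lemma par_neq v : v != o -> par v != v.
Proof. by move=> /dep_par; apply: contra_eq_neq => ->; elim: (dep v). Qed.

Lemma par_eq_root v : par v = v -> v = o.
Proof. by move=> h; apply: contraTeq isT => /par_neq; rewrite h eqxx. Qed.

Lemma adj_par v : v != o -> e v (par v).
Proof. by move=> vo; rewrite rooted_adj eq_sym par_neq ?eqxx. Qed.

Lemma par_adj v : v != o -> e (par v) v.
Proof. by move=> vo; rewrite rooted_adj par_neq ?eqxx ?orbT. Qed.

Lemma par_par_neq v : v != o -> par (par v) != v.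
Proof.
move=> vo; apply/negP => /eqP h; have := dep_par vo.
have [po|po] := eqVneq (par v) o; first by rewrite -h po par_root -po -h eqxx in vo.
by rewrite (dep_par po) h => /eqP; rewrite -addn2 -[X in X == _]addn0 eqn_add2l.
Qed.

Lemma root_ind (P : V -> Prop) :
  P o -> (forall v, v != o -> P (par v) -> P v) -> forall v, P v.
Proof.
move=> Po IH v; elim: {v}(dep v) {-2}v (erefl (dep v)) => [|n IHn] v dv.
  have [-> //|vo] := eqVneq v o; by rewrite dep_par in dv.
have [-> //|vo] := eqVneq v o; apply: IH => //; apply: IHn.
by have := dep_par vo; rewrite dv => -[].
Qed.

Lemma childrenP v w : reflect (w != o /\ par w = v) (w \in children v).
Proof.
have [_ _ nbE] := nbP v; rewrite mem_filter nbE rooted_adj.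
apply: (iffP idP) => [/and3P[wp vw /orP[/eqP h|/eqP h]]|[wo <-]].
- by rewrite h eqxx in wp.
- split=> //; apply/negP => /eqP wo; move: vw; rewrite -h wo par_root eqxx //.
- by rewrite par_neq // eqxx orbT eq_sym par_par_neq.
Qed.

Lemma uniq_children v : uniq (children v).
Proof. by have [u _ _] := nbP v; rewrite filter_uniq. Qed.

Lemma size_children v : v != o -> size (children v) = k.-1.
Proof.
move=> vo; have [u sz nbE] := nbP v.
by rewrite /children -rem_filter // size_rem ?sz // nbE adj_par.
Qed.

Section Extend.
Variable sg : V -> V.
Hypothesis sg_nb : forall w, w \in nb o -> sg w \in nb o.

(** Below the first level, child number i of a vertex goes to child number i of its image; hence
    everything below a fixed vertex other than the root is fixed. *)
Fixpoint extend_rec n v :=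
  if n is n'.+1 then
    if par v == o then sg v
    else nth o (children (extend_rec n' (par v))) (index v (children (par v)))
  else v.

Definition extend v := extend_rec (dep v) v.

Lemma extend_root : extend o = o.
Proof. by rewrite /extend; case: rootP => _ ->. Qed.

Lemma extendE v : v != o -> extend v = if par v == o then sg v
  else nth o (children (extend (par v))) (index v (children (par v))).
Proof. by move=> vo; rewrite {1}/extend dep_par. Qed.

Lemma nb_rootP w : reflect (w != o /\ par w = o) (w \in nb o).
Proof.
suff -> : nb o = children o by exact: childrenP.
have [_ _ nbE] := nbP o; apply/esym/all_filterP/allP => u.
by rewrite par_root nbE rooted_adj eq_sym => /andP[].
Qed.

Lemma extend_par v : v != o -> extend v != o /\ par (extend v) = extend (par v).
Proof.
elim/root_ind: v => [|v vo IH _]; first by rewrite eqxx.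
rewrite extendE //; case: (eqVneq (par v) o) => [pv|pv].
  have /nb_rootP[? ->] : sg v \in nb o by apply/sg_nb/nb_rootP.
  by rewrite pv extend_root.
have [ho _] := IH pv.
apply/childrenP; rewrite mem_nth // size_children // -(size_children pv) index_mem.
exact/childrenP.
Qed.

End Extend.

Lemma extendK sg sg' : (forall w, w \in nb o -> sg w \in nb o) ->
  {in nb o, cancel sg sg'} -> cancel (extend sg) (extend sg').
Proof.
move=> sgn sgK v; elim/root_ind: v => [|v vo IH]; first by rewrite !extend_root.
have [ho hp] := extend_par sgn vo; rewrite (extendE _ ho) hp.
have [pv|pv] := eqVneq (par v) o.
  by rewrite pv extend_root eqxx (extendE _ vo) pv eqxx sgK //; apply/nb_rootP.
have [hpo _] := extend_par sgn pv; rewrite (negPf hpo) IH (extendE _ vo) (negPf pv).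
have lt : index v (children (par v)) < size (children (extend sg (par v))).
  by rewrite size_children // -(size_children pv) index_mem; apply/childrenP.
by rewrite index_uniq ?uniq_children // nth_index //; apply/childrenP.
Qed.

Lemma extend_adj sg u v : (forall w, w \in nb o -> sg w \in nb o) ->
  e u v -> e (extend sg u) (extend sg v).
Proof.
move=> sgn; rewrite !rooted_adj => /andP[uv /orP[/eqP h|/eqP h]].
- have uo : u != o by apply: contra_neq uv => uo; rewrite -h uo par_root.
  by have [ho hp] := extend_par sgn uo; rewrite -h -hp eq_sym par_neq ?eqxx.
- have vo : v != o by apply: contra_neq uv => uo; rewrite -h uo par_root.
  by have [ho hp] := extend_par sgn vo; rewrite -h -hp par_neq ?eqxx ?orbT.
Qed.

(** The last clause will keep the revealed part of the tree untouched when a single star is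
    permuted. *)
Lemma ex_extend_aut sg sg' :
  (forall w, w \in nb o -> sg w \in nb o) -> (forall w, w \in nb o -> sg' w \in nb o) ->
  {in nb o, cancel sg sg'} -> {in nb o, cancel sg' sg} ->
  exists h : Aut e, [/\ h o = o, {in nb o, h =1 sg} &
    forall z z', z != o -> h z = z -> e z z' -> h z' = z'].
Proof.
move=> sgn sgn' sgK sgK'.
have hA : is_aut e (extend sg).
  split; first by exists (extend sg'); apply: extendK.
  move=> u v; apply/idP/idP; last exact: extend_adj.
  by move/(extend_adj sgn'); rewrite !extendK.
exists (MkAut (asboolT hA)); split=> /=; first exact: extend_root.
  by move=> w /nb_rootP[wo pw]; rewrite extendE // pw eqxx.
move=> z z' zo hz; rewrite rooted_adj => /andP[zz' /orP[/eqP h|/eqP h]].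
  by rewrite -h -(extend_par sgn zo).2 hz.
have z'o : z' != o by apply: contra_neq zz' => z'o; rewrite -h z'o par_root.
by rewrite extendE // h (negPf zo) hz nth_index //; apply/childrenP.
Qed.

End RootedTree.

(** Composing with [tperm j j'] shows that all [m] images of [i] are equally frequent. *)
Lemma card_perm_at (m : nat) (i j : 'I_m) :
  #|[pred s : {perm 'I_m} | s i == j]| * m = #|{perm 'I_m}|.
Proof.
have c j' : #|[pred s : {perm 'I_m} | s i == j']| = #|[pred s : {perm 'I_m} | s i == j]|.
  rewrite -!sum1_card (reindex_inj (mulIg (tperm j j'))) /=.
  apply: eq_bigl => s; rewrite !inE permM.
  by rewrite -(inj_eq (@perm_inj _ (tperm j j'))) tpermK tpermR.
transitivity (\sum_(j' < m) #|[pred s : {perm 'I_m} | s i == j']|).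
  by under eq_bigr do rewrite c; rewrite sum_nat_const card_ord mulnC.
rewrite -sum1_card (partition_big (fun s : {perm 'I_m} => s i) predT) //=.
by apply: eq_bigr => j' _; rewrite -sum1_card; apply: eq_bigl => s; rewrite !inE.
Qed.

Section LocalPerms.
Variables (V : choiceType) (e : rel V) (k : nat) (nb : V -> seq V).
Hypotheses (treeP : is_tree e) (nbP : neighbours e k nb).

Lemma aut_adj (g : Aut e) u v : e (g u) (g v) = e u v.
Proof. by case: (autP g). Qed.

Lemma aut_inj (g : Aut e) : injective g.
Proof. by case: (autP g) => /bij_inj. Qed.

Lemma autVK (g : Aut e) v : (g^-1)%g (g v) = v.
Proof. by have := mulVg g => /(congr1 (fun h : Aut e => h v)). Qed.

Lemma autKV (g : Aut e) v : g ((g^-1)%g v) = v.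
Proof. by have := mulgV g => /(congr1 (fun h : Aut e => h v)). Qed.

(* The cardinality clause makes all outcomes for a branch b other than s'
   equally likely, without computing any factorial. *)
Lemma ex_local_perms (s s' : V) : e s s' ->
  exists h : {perm 'I_k.-1} -> Aut e,
  [/\ forall p, h p s = s /\ h p s' = s',
      forall p z z', z != s -> h p z = z -> e z z' -> h p z' = z',
      forall p q, (forall w, e s w -> h p w = h q w) -> p = q,
      forall b b', e s b -> b != s' -> e s b' -> b' != s' ->
        #|[pred p | h p b == b']| * k.-1 = #|{perm 'I_k.-1}| &
      forall f : Aut e, f s = s -> f s' = s' ->
        exists p, forall w, e s w -> h p w = f w].
Proof.
move=> ss'; have [par [dep rootP]] := ex_rooting s treeP.
have [nbu nbs nbE] := nbP s.
pose t := [seq w <- nb s | w != s'].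
have ut : uniq t by rewrite filter_uniq.
have st : size t = k.-1.
  by rewrite /t -rem_filter // size_rem ?nbs // nbE.
have tE w : (w \in t) = (w != s') && e s w by rewrite mem_filter nbE.
pose T (i : 'I_k.-1) := nth s' t i.
have Tt i : T i \in t by rewrite mem_nth // st.
have Ts' i : T i != s' by have := Tt i; rewrite tE => /andP[].
have Te i : e s (T i) by have := Tt i; rewrite tE => /andP[].
have Tinj : injective T.
  by move=> i j /eqP; rewrite nth_uniq ?st // => /eqP/ord_inj.
have Tsurj w : w \in t -> exists i, w = T i.
  move=> wt; have lt : index w t < k.-1 by rewrite -st index_mem.
  by exists (Ordinal lt); rewrite /T /= nth_index.
have nbT w : w \in nb s -> w = s' \/ exists i, w = T i.
  rewrite nbE => ew; have [->|ws'] := eqVneq w s'; [by left|right].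
  by apply: Tsurj; rewrite tE ws'.
pose sg (p : {perm 'I_k.-1}) w :=
  if [pick i | T i == w] is Some i then T (p i) else w.
have sgT p i : sg p (T i) = T (p i).
  by rewrite /sg; case: pickP => [j /eqP/Tinj -> //|/(_ i)]; rewrite eqxx.
have sgs' p : sg p s' = s'.
  by rewrite /sg; case: pickP => // j /eqP h; have := Ts' j; rewrite h eqxx.
have sgn p w : w \in nb s -> sg p w \in nb s.
  by move=> /nbT[->|[i ->]]; rewrite ?sgs' ?sgT nbE.
have sgK p : {in nb s, cancel (sg p) (sg (p^-1)%g)}.
  by move=> w /nbT[->|[i ->]]; rewrite ?sgs' ?sgT // permK.
have sgK' p : {in nb s, cancel (sg (p^-1)%g) (sg p)}.
  by move=> w /nbT[->|[i ->]]; rewrite ?sgs' ?sgT // permKV.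
have /choice[h hP] p := ex_extend_aut rootP nbP (sgn p) (sgn (p^-1)%g) (sgK p) (sgK' p).
have hT p i : h p (T i) = T (p i).
  by have [_ E _] := hP p; rewrite E ?nbE ?sgT ?Te.
have hs' p : h p s' = s' by have [_ E _] := hP p; rewrite E ?nbE ?sgs'.
exists h; split.
- by move=> p; have [-> _ _] := hP p; rewrite hs'.
- by move=> p; have [_ _] := hP p.
- move=> p q hpq; apply/permP => i; apply: Tinj.
  by rewrite -!hT hpq.
- move=> b b' sb bs' sb' b's'.
  have [i ->] : exists i, b = T i by apply: Tsurj; rewrite tE bs'.
  have [j ->] : exists i, b' = T i by apply: Tsurj; rewrite tE b's'.
  rewrite -(card_perm_at i j); congr (_ * _); apply: eq_card => p.
  by rewrite !inE hT (inj_eq Tinj).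
- move=> f fs fs'.
  have fT i : exists j, f (T i) = T j.
    apply: Tsurj; rewrite tE -{1}fs' (inj_eq (@aut_inj f)) Ts' /=.
    by rewrite -fs aut_adj.
  have [F FP] := choice fT.
  have Finj : injective F.
    by move=> i j Fij; apply/Tinj/(@aut_inj f); rewrite !FP Fij.
  exists (perm Finj) => w; rewrite -nbE => /nbT[->|[i ->]]; first by rewrite hs' fs'.
  by rewrite hT permE FP.
Qed.

End LocalPerms.

(** * Words and trajectories *)

Section Words.
Variables (V : choiceType) (e : rel V).
Implicit Types (g h : Aut e) (l : bool * Aut e) (w : seq (bool * Aut e)) (v : V).

(* The letter (b, a) stands for t a if b holds and for t^-1 a otherwise; the
   last letter of a word acts first. *)
Definition lettA g l : Aut e := ((if l.1 then g else g^-1) * l.2)%g.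

Fixpoint wordA g w : Aut e := if w is l :: w' then (lettA g l * wordA g w')%g else 1%g.

(* When l acts on z, it uses the value of g at the vertex domA g l z. *)
Definition domA g l : Aut e := ((if l.1 then 1 else g^-1) * l.2)%g.

(** Letter number [i], counted from the left, uses [g] at [pointA g w i v]. As automorphisms, these
    maps are injective and preserve adjacency. *)
Fixpoint pointA g w i : Aut e :=
  match w, i with
  | [::], _ => 1%g
  | l :: w', 0 => (domA g l * wordA g w')%g
  | l :: w', i'.+1 => pointA g w' i'
  end.

Definition traj g w v := [seq pointA g w i v | i <- iota 0 (size w)].

Lemma trajP g w v x :
  reflect (exists2 i, i < size w & x = pointA g w i v) (x \in traj g w v).
Proof.
apply: (iffP mapP) => -[i]; first by rewrite mem_iota => ? ->; exists i.
by move=> iw ->; exists i; rewrite ?mem_iota.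
Qed.

Lemma traj_mem g w v i : i < size w -> pointA g w i v \in traj g w v.
Proof. by move=> iw; apply/trajP; exists i. Qed.

Lemma uniq_traj_inj g w v i j : uniq (traj g w v) -> i < size w -> j < size w ->
  pointA g w i v = pointA g w j v -> i = j.
Proof.
move=> u iw jw eq_ij; have szE : size (traj g w v) = size w by rewrite size_map size_iota.
have nthE n : n < size w -> nth v (traj g w v) n = pointA g w n v.
  by move=> nw; rewrite (nth_map 0) ?size_iota // nth_iota.
by apply/eqP; rewrite -(nth_uniq v _ _ u) ?szE // !nthE // eq_ij.
Qed.

Lemma wordA_cat g w1 w2 : wordA g (w1 ++ w2) = (wordA g w1 * wordA g w2)%g.
Proof. by elim: w1 => [|l w1 IH] /=; rewrite ?mul1g // IH mulgA. Qed.

Lemma pointA_cat g w1 w2 i : pointA g (w1 ++ w2) (size w1 + i) = pointA g w2 i.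
Proof. by elim: w1. Qed.

Lemma pointA_catl g w1 w2 i : i < size w1 ->
  pointA g (w1 ++ w2) i = (pointA g w1 i * wordA g w2)%g.
Proof.
elim: w1 i => [|l w1 IH] [|i] //= iw; last exact: IH.
by rewrite wordA_cat mulgA.
Qed.

(** A letter [t^-1] also uses a single value of [g]: from [g' x = g x] the two inverses agree at
    [g x]. *)
Lemma agree_on_traj g g' w v :
  (forall i, i < size w -> g' (pointA g w i v) = g (pointA g w i v)) ->
  (forall i, i < size w -> pointA g' w i v = pointA g w i v) /\
  wordA g' w v = wordA g w v.
Proof.
elim: w => [//|[b a] w IH] gg'.
have [IHp IHw] := IH (fun i iw => gg' i.+1 iw).
have := gg' 0 isT; rewrite /= /lettA /domA /=; set z := wordA g w v.
case: b gg' => gg' /= h0.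
  by split=> [[|i] iw|] /=; rewrite /domA /= ?IHp ?IHw.
have h1 : (g'^-1)%g (a z) = (g^-1)%g (a z).
  by rewrite -[in LHS](autKV g (a z)) -h0 autVK.
by split=> [[|i] iw|] /=; rewrite /domA /= ?IHp ?IHw.
Qed.

Lemma agree_traj g g' w v :
  (forall x, x \in traj g w v -> g' x = g x) ->
  traj g' w v = traj g w v /\ wordA g' w v = wordA g w v.
Proof.
move=> h; have [hp ->] := @agree_on_traj g g' w v (fun i iw => h _ (traj_mem _ _ iw)).
by split=> //; apply/eq_in_map => i; rewrite mem_iota => /hp.
Qed.

End Words.

(** * Exploring an automorphism along finite subtrees *)

Section Exploration.
Variables (V : choiceType) (e : rel V) (k : nat).
Variables (o : V) (par : V -> V) (dep : V -> nat).
Hypothesis rootP : rooting e o par dep.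
Hypothesis treeP : is_tree e.
Variables (w : seq (bool * Aut e)) (B : seq V).
Implicit Types (g h : Aut e) (v x y z : V) (I : seq V).

(* A list I containing the root and closed under par is a finite subtree; its
   closed neighbourhood is then star I, and the leaves of star I are the x
   outside I with par x in I. *)
Definition star I : pred V := [pred v | par v \in I].

Definition cyl I g : set (Aut e) := [set h | forall v, v \in star I -> h v = g v].

(* B is a finite exceptional set, interior from the start, at which
   trajectories may meet themselves. *)
Definition good I g v := [/\ {subset traj g w v <= star I}, wordA g w v = v &
  v \in B \/ uniq (traj g w v)].

(** If [w(g)] fixes [o], it fixes all ancestors of a fixed vertex; asking goodness of the whole path
    makes vertices appear only as children of good ones. *)
Definition goods I g v := forall n, good I g (iter n par v).

Definition active I g v := goods I g v /\ ~ {subset traj g w v <= I}.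

Definition config I g := [/\ o \in I, forall v, v \in I -> par v \in I,
  o \in B, wordA g w o = o & forall u, u \in B -> {subset traj g w u <= I}].

Lemma cyl_refl I g : cyl I g g. Proof. by []. Qed.

Lemma cyl_sym I g h : cyl I g h -> cyl I h g.
Proof. by move=> gh v vI; rewrite gh. Qed.

Lemma cyl_cons I x g h : cyl (x :: I) g h -> cyl I g h.
Proof. by move=> gh v vI; rewrite gh // inE in_cons; move: vI; rewrite inE => ->; rewrite orbT. Qed.

Lemma cyl_traj I g h v : cyl I g h -> {subset traj g w v <= star I} ->
  traj h w v = traj g w v /\ wordA h w v = wordA g w v.
Proof. by move=> gh sub; apply: agree_traj => x /sub/gh. Qed.

Lemma good_cyl I g h v : cyl I g h -> good I g v -> good I h v.
Proof. by move=> gh [sub fx u]; rewrite /good; have [-> ->] := cyl_traj gh sub. Qed.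

Lemma goods_cyl I g h v : cyl I g h -> goods I g v -> goods I h v.
Proof. by move=> gh gv n; apply: good_cyl gh (gv n). Qed.

Lemma active_cyl I g h v : cyl I g h -> active I g v -> active I h v.
Proof.
move=> gh [gv tv]; split; first exact: goods_cyl gh gv.
by have [-> _] := cyl_traj gh (let: And3 s _ _ := gv 0 in s).
Qed.

Lemma goodsS I g v : goods I g v <-> good I g v /\ goods I g (par v).
Proof.
split=> [gv|[g0 gv] [|n]] //; last by rewrite iterSr.
by split=> [|n]; [exact: (gv 0) | rewrite -iterSr].
Qed.

Lemma goods_par I g v : goods I g v -> goods I g (par v).
Proof. by move=> /goodsS[]. Qed.

Lemma goods_good I g v : goods I g v -> good I g v.
Proof. by move=> /goodsS[]. Qed.

Lemma leaf_nbr I y z : y \notin I -> e y z -> z \in star I -> z = par y.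
Proof.
move=> yI; rewrite (rooted_adj rootP) => /andP[_ /orP[/eqP-> //|/eqP zy]].
by rewrite inE zy (negPf yI).
Qed.

Lemma nbr_star I y z : (forall v, v \in I -> par v \in I) -> y \in I -> e y z -> z \in star I.
Proof.
move=> dI yI; rewrite (rooted_adj rootP) inE => /andP[_ /orP[/eqP<-|/eqP-> //]].
exact/dI/dI.
Qed.

Lemma root_goods I g : config I g -> goods I g o.
Proof.
case=> oI dI oB fo tB n; have -> : iter n par o = o.
  by elim: n => //= n ->; exact: (par_root rootP).
by split => //; [move=> x /(tB _ oB)/dI | left].
Qed.

Lemma config_cyl I g h : cyl I g h -> config I g -> config I h.
Proof.
move=> gh cf; have [oI dI oB fo tB] := cf.
have sB u : u \in B -> {subset traj g w u <= star I} by move=> uB x /(tB _ uB)/dI.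
split=> //; first by rewrite (cyl_traj gh (sB _ oB)).2.
by move=> u uB; rewrite (cyl_traj gh (sB _ uB)).1; exact: tB.
Qed.

Lemma config_cons I x g : config I g -> par x \in I -> config (x :: I) g.
Proof.
case=> oI dI oB fo tB px; split=> //; rewrite ?in_cons ?oI ?orbT //.
- by move=> v; rewrite !in_cons => /orP[/eqP->|/dI->]; rewrite ?px orbT.
- by move=> u uB y /(tB _ uB); rewrite in_cons => ->; rewrite orbT.
Qed.

Lemma active_notin I g v : config I g -> active I g v -> v \notin B.
Proof. by case=> _ _ _ _ tB [_ nt]; apply/negP => /tB. Qed.

Lemma active_neq_root I g v : config I g -> active I g v -> v != o.
Proof.
move=> cf av; have := active_notin cf av; apply: contra => /eqP ->.
by case: cf.
Qed.

Lemma active_uniq I g v : config I g -> active I g v -> uniq (traj g w v).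
Proof.
move=> cf av; have := active_notin cf av.
by have [/goods_good[_ _ []] ] := av => // ->.
Qed.

Lemma pointA_leaf I g v v' i : e v v' -> i < size w ->
  pointA g w i v \notin I -> pointA g w i v' \in star I ->
  pointA g w i v' = par (pointA g w i v).
Proof. by move=> vv' iw vI v'I; apply: leaf_nbr v'I => //; rewrite aut_adj. Qed.

Section Step.
Variables (I : seq V) (x : V) (g g' : Aut e).
Hypotheses (cf : config I g) (xI : x \notin I) (px : par x \in I) (gg' : cyl I g g').

Lemma star_cons y : y \in star I -> y \in star (x :: I).
Proof. by rewrite !inE => ->; rewrite orbT. Qed.

Lemma new_leaf y : y \in star (x :: I) -> y \notin star I -> par y = x /\ y \notin x :: I.
Proof.
have [oI dI _ _ _] := cf; rewrite !inE => /orP[/eqP py _|-> //]; split=> //.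
rewrite negb_or; apply/andP; split.
  apply/negP => /eqP yx; have xo : x = o by apply: (par_eq_root rootP); rewrite -{1}yx.
  by move: (xI); rewrite xo oI.
by apply/negP => /dI; rewrite py (negPf xI).
Qed.

(** Trajectories of adjacent vertices are adjacent step by step, and the new leaves are children of
    [x]: when [u] is at one of them, its parent is at [x]. *)
Lemma goods_new u : goods (x :: I) g' u -> ~ goods I g u ->
  goods I g (par u) /\ exists i, [/\ i < size w, pointA g' w i u \notin star I
   & pointA g w i (par u) = x].
Proof.
elim/(root_ind rootP): u => [_ []|u uo IH]; first exact: root_goods.
move=> gu ngu.
(* If the parent were new as well, step [i] would put it at a leaf of the larger star, and [u] and
   [par (par u)] would both go to the parent of that leaf. *)
have [pu|npu] := pselect (goods I g (par u)); last first.
  have po : par u != o by apply/negP => /eqP h; apply: npu; rewrite h; exact: root_goods.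
  have [ppu [i [iw inS ix]]] := IH (goods_par gu) npu.
  have gpu := goods_good (goods_par gu).
  have [_ pE] := new_leaf (let: And3 s _ _ := gpu in s _ (traj_mem g' (par u) iw)) inS.
  have uE y : e (par u) y -> y = u \/ y = par (par u) ->
      pointA g' w i y \in star (x :: I) -> pointA g' w i y = par (pointA g' w i (par u)).
    by move=> ey _; apply: pointA_leaf.
  case: (negP (par_par_neq rootP uo)); apply/eqP/(@aut_inj _ _ (pointA g' w i)).
  rewrite (uE u) ?(par_adj rootP) //; [|by left|].
    apply: uE; [exact: (adj_par rootP)|by right|].
    by have [s _ _] := goods_good (goods_par (goods_par gu)); apply/s/traj_mem.
  by have [s _ _] := goods_good gu; apply/s/traj_mem.
split=> //; have [s' f' u'] := goods_good gu.
have : ~ {subset traj g' w u <= star I}.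
  move=> s; apply: ngu; apply/goodsS; split=> //.
  by apply: (good_cyl (cyl_sym gg')).
move=> /existsNP[_ /not_implyP[/trajP[i iw ->] /negP inS]].
exists i; split => //.
have [py yN] := new_leaf (s' _ (traj_mem g' u iw)) inS.
have [ps _ _] := goods_good pu.
have pE : pointA g' w i (par u) = pointA g w i (par u).
  by have [+ _] := agree_on_traj (fun j jw => gg' (ps _ (traj_mem g (par u) jw))); apply.
rewrite -pE -py; apply: (@pointA_leaf (x :: I)) => //; first exact: (adj_par rootP).
by rewrite pE; apply/star_cons/ps/traj_mem.
Qed.

(** Of the stars on the trajectory of [v], only that of [x] is missing. *)
Definition resolved v := active I g v /\ {subset traj g w v <= x :: I}.

Lemma resolved_active v : resolved v -> active I g v. Proof. by case. Qed.

Lemma resolved_mem v : resolved v -> x \in traj g w v.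
Proof.
move=> [[_ nt] s]; move/existsNP: nt => [y /not_implyP[yt /negP yI]].
by have := s _ yt; rewrite in_cons (negPf yI) orbF => /eqP <-.
Qed.

Lemma goods_pointA v i : goods I g v -> i < size w ->
  pointA g w i v \in star I /\ pointA g' w i v = pointA g w i v.
Proof.
move=> /goods_good[s _ _] iw; split; first exact/s/traj_mem.
by have [+ _] := agree_on_traj (fun j jw => gg' (s _ (traj_mem g v jw))); apply.
Qed.

(** A vertex not good before is a child of one passing through [x]; a second leaf on the parent's
    trajectory would give [v] and its grandparent the same image, so the parent is resolved. *)
Lemma active_step v : active (x :: I) g' v ->
  (active I g v /\ ~ resolved v) \/ [/\ v != o, resolved (par v) & wordA g' w v = v].
Proof.
move=> [gv nt]; have [s' f' u'] := goods_good gv.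
have [gI|ngI] := pselect (goods I g v).
  have [s _ _] := goods_good gI; have [tE _] := cyl_traj gg' s.
  left; split; last by move=> [_]; rewrite -tE.
  by split=> // st; apply: nt; rewrite tE => y /st; rewrite in_cons => ->; rewrite orbT.
right; have [gp [i [iw inS ix]]] := goods_new gv ngI.
have vo : v != o by apply/negP => /eqP vo; apply: ngI; rewrite vo; exact: root_goods.
have ap : active I g (par v).
  by split=> // sp; have := sp _ (traj_mem g (par v) iw); rewrite ix (negPf xI).
split=> //; split=> // y /trajP[j jw ->]; apply: contraT => jN.
have po := active_neq_root cf ap.
case: (negP (par_par_neq rootP vo)); apply/eqP/(@aut_inj _ _ (pointA g' w j)).
have [jS jE] := goods_pointA gp jw.
have [jS2 jE2] := goods_pointA (goods_par gp) jw.
rewrite -jE in jN.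
rewrite (pointA_leaf (par_adj rootP vo) jw jN); last exact/s'/traj_mem.
apply: (pointA_leaf _ jw jN); first exact: (adj_par rootP).
by rewrite jE2; apply: star_cons.
Qed.

Lemma resolved_child_new v : v != o -> resolved (par v) -> ~ goods I g v.
Proof.
move=> vo rp gv; have ap := resolved_active rp; have po := active_neq_root cf ap.
have /trajP[i iw ix] := resolved_mem rp.
case: (negP (par_par_neq rootP vo)); apply/eqP/(@aut_inj _ _ (pointA g w i)).
have iN : pointA g w i (par v) \notin I by rewrite -ix.
rewrite (pointA_leaf (par_adj rootP vo) iw iN); last exact: (goods_pointA gv iw).1.
apply: (pointA_leaf (adj_par rootP po) iw iN).
by have [+ _] := goods_pointA (goods_par ap.1) iw.
Qed.

End Step.

End Exploration.

(** * The branching process of active vertices *)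

Section Branching.
Variables (V : choiceType) (e : rel V) (k : nat) (nb : V -> seq V).
Variables (o : V) (par : V -> V) (dep : V -> nat).
Hypothesis rootP : rooting e o par dep.
Hypothesis treeP : is_tree e.
Hypothesis nbP : neighbours e k nb.
Hypothesis k_gt2 : 2 < k.
Variables (w : seq (bool * Aut e)) (B : seq V).
Hypothesis w_neq0 : w != [::].
Implicit Types (g h : Aut e) (v x y z : V) (I : seq V).

Local Notation star := (star par).
Local Notation cyl := (@cyl V e par).
Local Notation goods := (@goods V e par w B).
Local Notation active := (@active V e par w B).
Local Notation config := (@config V e o par w B).
Local Notation resolved := (@resolved V e par w B).
Local Notation children := (children par nb).

(* Write w = w1 l w2, where the letter l is the one that applies g at x.  The
   values of g' that w2 and w1^-1 use at the neighbours of v are known, so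
   w(g') c = c amounts to one equation at x. *)
Lemma resolved_eqn I x g v : config I g -> x \notin I -> par x \in I ->
  resolved I x g v ->
  exists b1 b2 : Aut e, [/\ b1 v = x, b2 v = g x, b1 (par v) = par x,
    b2 (par v) = g (par x) & forall g' c, cyl I g g' -> e v c ->
    (wordA g' w c = c <-> g' (b1 c) = b2 c)].
Proof.
move=> cf xI px rv; have av := resolved_active rv; have uv := active_uniq cf av.
have vo := active_neq_root cf av; have [_ dI _ _ _] := cf.
have /trajP[i iw ix] := resolved_mem rv.
have inI j : j < size w -> j != i -> pointA g w j v \in I.
  move=> jw ji; have := rv.2 _ (traj_mem g v jw); rewrite in_cons => /orP[/eqP jx|//].
  by rewrite (uniq_traj_inj uv iw jw) ?eqxx // -?ix // in ji.
have [w1 [l [w2 [wE szw1]]]] : exists w1 l w2, w = w1 ++ l :: w2 /\ size w1 = i.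
  exists (take i w), (nth (true, 1%g) w i), (drop i.+1 w).
  by rewrite -drop_nth // cat_take_drop size_take iw.
set u := wordA g w2; pose z := ((wordA g w1)^-1)%g.
have fv : wordA g w v = v by have [_ ->] := goods_good av.1.
have zv : lettA g l (u v) = z v.
  by rewrite -{2}fv wE wordA_cat /= /z [X in _ = _ X]/= autVK.
have xE : x = domA g l (u v) by rewrite ix wE -szw1 -[size w1]addn0 pointA_cat.
have w1I j : j < size w1 -> pointA g w1 j (z v) \in I.
  move=> jw; have -> : pointA g w1 j (z v) = pointA g w j v by rewrite wE pointA_catl // -zv.
  apply: inI; first by rewrite wE size_cat (leq_trans jw) // leq_addr.
  by rewrite neq_ltn -szw1 jw.
have w2I j : j < size w2 -> pointA g w2 j v \in I.
  move=> jw; have -> : pointA g w2 j v = pointA g w (size w1 + j.+1) v.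
    by rewrite wE pointA_cat.
  apply: inI; first by rewrite wE size_cat ltn_add2l.
  by rewrite -szw1 -[X in _ != X]addn0 eqn_add2l.
have w1z g' c : cyl I g g' -> e v c -> wordA g' w1 (z c) = c.
  move=> gg' vc; rewrite -[RHS](autKV (wordA g w1)).
  apply: (agree_on_traj _).2 => j jw; apply: gg'.
  by apply: (nbr_star rootP dI (w1I j jw)); rewrite !aut_adj.
have w2u g' c : cyl I g g' -> e v c -> wordA g' w2 c = u c.
  move=> gg' vc; apply: (agree_on_traj _).2 => j jw; apply: gg'.
  by apply: (nbr_star rootP dI (w2I j jw)); rewrite !aut_adj.
have eqn g' c : cyl I g g' -> e v c -> (wordA g' w c = c <-> lettA g' l (u c) = z c).
  move=> gg' vc; rewrite wE wordA_cat /= -(w2u g') //.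
  split=> [h|h]; last by rewrite /= h w1z.
  by apply: (@aut_inj _ _ (wordA g' w1)); rewrite w1z.
have fp : wordA g w (par v) = par v by have [_ ->] := goods_good (goods_par av.1).
have vp : e v (par v) by exact: (adj_par rootP).
have pE : domA g l (u (par v)) = par x.
  have -> : domA g l (u (par v)) = pointA g w i (par v).
    by rewrite wE -szw1 -[size w1]addn0 pointA_cat.
  rewrite ix; apply: (pointA_leaf (I := I) rootP vp iw); first by rewrite -ix.
  by have [] := goods_pointA (@cyl_refl _ _ par I g) (goods_par av.1) iw.
have /(eqn _ _ (@cyl_refl _ _ _ _ _) vp) zp := fp.
(* The equation is read forwards for the letter [t] and backwards for [t^-1], which exchanges the
   roles of [b1] and [b2]. *)
case: l @u eqn zv xE pE zp {wE} w2u => [[] a] u eqn zv xE pE zp w2u.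
  exists (a * u)%g, z; split => //; first by rewrite -zv xE.
  by rewrite -zp -pE.
exists z, (a * u)%g; split.
- by rewrite -zv xE.
- by rewrite xE /= autKV.
- by rewrite -zp -pE.
- by rewrite -pE /= autKV.
- move=> g' c gg' vc; rewrite eqn // /lettA /=; split=> [<-|<-]; first by rewrite autKV.
  by rewrite autVK.
Qed.

Lemma star_finite I : exists r : seq V, r =i star I.
Proof.
exists [seq v <- o :: flatten (map nb I) | v \in star I] => v.
rewrite mem_filter; case: (boolP (v \in star I)) => //= vI.
rewrite in_cons; have [//|vo] := eqVneq v o.
apply/flattenP; exists (nb (par v)); first exact: map_f.
by have [_ _ ->] := nbP (par v); exact: (par_adj rootP).
Qed.

(** The first point of the trajectory is the image of [v] under an injective map and lies in the
    finite star. *)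
Lemma finite_goods I g : finite_set [set v | goods I g v].
Proof.
have [l [w' wE]] : exists l w', w = l :: w' by case: w w_neq0 => // l w' _; exists l, w'.
pose P := pointA g w 0.
have [r rE] := star_finite I.
have fS : finite_set [set` star I].
  by apply/finite_seqP; exists r; apply/seteqP; split=> v /=; rewrite rE.
apply: (@sub_finite_set _ _ (P @^-1` [set` star I])).
  by move=> v /goods_good[s _ _]; apply: s; apply: traj_mem; rewrite wE.
by apply: finite_preimage fS => a b _ _; exact: aut_inj.
Qed.

Lemma finite_active I g : finite_set (active I g).
Proof. by apply: sub_finite_set (finite_goods I g) => v []. Qed.

Definition act I g : seq V := enum_fset (fset_set (active I g)).

Lemma mem_act I g v : v \in act I g <-> active I g v.
Proof. by rewrite /act in_fset_set; [split; rewrite inE | exact: finite_active]. Qed.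

Lemma uniq_act I g : uniq (act I g). Proof. exact: fset_uniq. Qed.

(* candidates I x g g' is what act (x :: I) g' would be if no trajectory of a
   fixed child ever met itself. *)
Definition newborn I x g g' :=
  [seq c <- flatten [seq children v | v <- act I g & `[<resolved I x g v>]] | wordA g' w c == c].

Definition candidates I x g g' :=
  [seq v <- act I g | ~~ `[<resolved I x g v>]] ++ newborn I x g g'.

Lemma mem_newborn I x g g' c : c \in newborn I x g g' <->
  [/\ c != o, resolved I x g (par c) & wordA g' w c = c].
Proof.
rewrite mem_filter; split.
  move=> /andP[/eqP fc /flattenP[_ /mapP[v +] ->]] /(childrenP rootP nbP)[co cp].
  by rewrite mem_filter => /andP[/asboolP rv _]; rewrite cp.
move=> [co rp ->]; rewrite eqxx; apply/flattenP; exists (children (par c)).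
  apply/map_f; rewrite mem_filter; apply/andP; split; first exact/asboolP.
  by apply/mem_act; exact: resolved_active rp.
exact/(childrenP rootP nbP).
Qed.

Lemma mem_candidates I x g g' c : c \in candidates I x g g' <->
  (active I g c /\ ~ resolved I x g c) \/ [/\ c != o, resolved I x g (par c) & wordA g' w c = c].
Proof.
rewrite mem_cat mem_filter; split.
  case/orP => [/andP[/asboolPn nr /mem_act a]|/mem_newborn]; by [left|right].
case=> [[/mem_act -> /asboolPn ->] //|/mem_newborn ->]; exact: orbT.
Qed.

Lemma act_sub_candidates I x g g' : config I g -> x \notin I -> par x \in I ->
  cyl I g g' -> {subset act (x :: I) g' <= candidates I x g g'}.
Proof.
by move=> cf xI px gg' v /mem_act av; apply/mem_candidates; exact: (active_step rootP).
Qed.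

Section Outcomes.
Variables (I : seq V) (x : V) (g : Aut e).
Hypotheses (cf : config I g) (xI : x \notin I) (px : par x \in I).

Let x_neq_root : x != o.
Proof. by apply: contraNneq xI => ->; have [] := cf. Qed.

Let adj_x : e (g x) (g (par x)). Proof. by rewrite aut_adj (adj_par rootP). Qed.

Let starpx : par x \in star I. Proof. by have [_ dI _ _ _] := cf; exact: dI. Qed.

Definition outcome : {perm 'I_k.-1} -> Aut e := sval (cid (ex_local_perms treeP nbP adj_x)).

(** Each outcome follows [g] by a permutation of the branches at [g x] that keeps the one towards
    [g (par x)]. *)
Definition nextA p : Aut e := (outcome p * g)%g.

(** From [g (par x)] fixedness spreads up to [g o] and then down through [I], never across [g x]
    since [x] is not in [I]. *)
Lemma next_cyl p : cyl I g (nextA p).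
Proof.
have [oI dI _ _ _] := cf.
have [fx cl _ _ _] := svalP (cid (ex_local_perms treeP nbP adj_x)).
have {}fx : outcome p (g (par x)) = g (par x) by have [] := fx p.
have {}cl z z' : z \in I -> outcome p (g z) = g z -> e z z' -> outcome p (g z') = g z'.
  move=> zI hz zz'; apply: cl hz _; last by rewrite aut_adj.
  by rewrite (inj_eq (@aut_inj _ _ g)); apply: contraNneq xI => <-.
have ho : outcome p (g o) = g o.
  move: fx px; elim/(root_ind rootP): (par x) => [//|v vo IH] hv vI.
  by apply: IH; [exact: cl vI hv (adj_par rootP vo) | exact: dI].
move=> v; elim/(root_ind rootP): v => [//|v vo IH]; rewrite inE => pv.
by apply: (cl _ _ pv); [apply: IH; exact: dI | exact: (par_adj rootP)].
Qed.

Lemma cyl_next h : cyl I g h -> exists p, cyl (x :: I) (nextA p) h.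
Proof.
move=> gh; have [fx _ _ _ ex] := svalP (cid (ex_local_perms treeP nbP adj_x)).
have [||p hp] := ex (h * g^-1)%g; rewrite /= ?autVK ?gh //.
exists p => v; rewrite inE in_cons => /orP[/eqP pv|vI].
  rewrite [RHS](hp (g v)) /= ?autVK // aut_adj -pv; apply: (par_adj rootP).
  by apply: contraNneq xI => vo; have [oI _ _ _ _] := cf; rewrite -pv vo (par_root rootP).
by rewrite gh // -(next_cyl p).
Qed.

Lemma next_inj h p q : cyl (x :: I) (nextA p) h -> cyl (x :: I) (nextA q) h -> p = q.
Proof.
move=> hp hq; have [_ _ inj _ _] := svalP (cid (ex_local_perms treeP nbP adj_x)).
apply: inj => v xv; rewrite -[v](autKV g) in xv *.
set y := (g^-1)%g v in xv *.
suff yS : y \in star (x :: I) by have := hp y yS; rewrite (hq y yS).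
move: xv; rewrite aut_adj (rooted_adj rootP) inE in_cons => /andP[_ /orP[/eqP<-|/eqP->]].
  by move: starpx; rewrite inE => ->; rewrite orbT.
by rewrite eqxx.
Qed.

Lemma resolved_adj v c : resolved I x g v -> c \in children v -> e v c /\ c != par v.
Proof.
move=> rv /(childrenP rootP nbP)[co <-]; rewrite (par_adj rootP) //.
by split=> //; rewrite eq_sym (par_par_neq rootP).
Qed.

(** By [resolved_eqn], [c] is fixed exactly when the outcome sends a prescribed branch at [g x] to a
    prescribed branch, which has probability [1 / (k - 1)]. *)
Lemma card_fixing v c : resolved I x g v -> c \in children v ->
  #|[pred p | wordA (nextA p) w c == c]| * k.-1 = #|{perm 'I_k.-1}|.
Proof.
move=> rv /(resolved_adj rv)[vc cp].
have [b1 [b2 [b1v b2v b1p b2p eqn]]] := resolved_eqn cf xI px rv.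
have [_ _ _ cnt _] := svalP (cid (ex_local_perms treeP nbP adj_x)).
rewrite -(cnt (g (b1 c)) (b2 c)).
- congr (_ * _); apply: eq_card => p; rewrite !inE.
  by apply/eqP/eqP => /(eqn _ _ (next_cyl p) vc).
- by rewrite -b1v !aut_adj.
- by rewrite -b1p !(inj_eq (@aut_inj _ _ _)).
- by rewrite -b2v aut_adj.
- by rewrite -b2p (inj_eq (@aut_inj _ _ _)).
Qed.

(** The martingale identity: each of the [k - 1] children of a resolved vertex is fixed with
    probability [1 / (k - 1)], so one is on average. *)
Lemma sum_candidates :
  \sum_p size (candidates I x g (nextA p)) = #|{perm 'I_k.-1}| * size (act I g).
Proof.
under eq_bigr do rewrite size_cat.
pose P v := `[<resolved I x g v>].
rewrite big_split /= sum_nat_const addnC -(count_predC P (act I g)) mulnDr size_filter.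
congr (_ + _).
transitivity (\sum_(v <- act I g | `[<resolved I x g v>])
   \sum_(c <- children v) #|[pred p | wordA (nextA p) w c == c]|).
  rewrite -[RHS]big_filter.
  transitivity (\sum_(p : {perm 'I_k.-1}) \sum_(v <- [seq v <- act I g | `[<resolved I x g v>]])
     \sum_(c <- children v) (wordA (nextA p) w c == c : nat)).
    apply: eq_bigr => p _; rewrite /newborn size_filter -sum1_count big_flatten big_map.
    by apply: eq_bigr => v _; rewrite big_mkcond; apply: eq_bigr => c _; case: eqP.
  rewrite exchange_big; apply: eq_bigr => v _; rewrite exchange_big; apply: eq_bigr => c _.
  by rewrite -sum1_card [RHS]big_mkcond; apply: eq_bigr => p _; rewrite inE; case: eqP.
rewrite -sum1_count big_distrr /= big_seq_cond [RHS]big_seq_cond.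
apply: eq_bigr => v /andP[_ /asboolP rv]; rewrite muln1.
have k1 : 0 < k.-1 by case: k k_gt2 => [|[]].
apply/eqP; rewrite -(eqn_pmul2r k1); apply/eqP.
rewrite big_distrl /= big_seq.
under eq_bigr => c cc do rewrite (card_fixing rv cc).
rewrite -big_seq big_const_seq count_predT iter_addn_0.
rewrite (size_children rootP nbP) //.
exact: (active_neq_root cf (resolved_active rv)).
Qed.

(** The equations for all children ask [g'] to be [b2 b1^-1] around [x]; this agrees with [g] at [x]
    and [par x], so some outcome realizes it. *)
Lemma next_all_children v : resolved I x g v ->
  exists p, forall c, c \in children v -> wordA (nextA p) w c = c.
Proof.
move=> rv; have [b1 [b2 [b1v b2v b1p b2p eqn]]] := resolved_eqn cf xI px rv.
have [_ _ _ _ ex] := svalP (cid (ex_local_perms treeP nbP adj_x)).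
have b1V u : (b1^-1)%g (b1 u) = u by rewrite autVK.
have [||p hp] := ex (b2 * (b1^-1 * g^-1))%g.
- by rewrite /= autVK -{1}b1v b1V.
- by rewrite /= autVK -{1}b1p b1V.
exists p => c /(resolved_adj rv)[vc _]; apply/(eqn _ _ (next_cyl p) vc).
by rewrite [LHS]hp /= ?autVK ?b1V // -b1v !aut_adj.
Qed.

End Outcomes.

End Branching.

(** * Growth of the number of active vertices near the optimum *)

Section Growth.
Variables (V : choiceType) (e : rel V) (k : nat) (nb : V -> seq V).
Variables (o : V) (par : V -> V) (dep : V -> nat).
Hypothesis rootP : rooting e o par dep.
Hypothesis treeP : is_tree e.
Hypothesis nbP : neighbours e k nb.
Hypothesis k_gt2 : 2 < k.
Variables (w : seq (bool * Aut e)) (B : seq V).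
Hypothesis w_neq0 : w != [::].
Implicit Types (g h : Aut e) (v x y z : V) (I : seq V).

Local Notation star := (star par).
Local Notation cyl := (@cyl V e par).
Local Notation goods := (@goods V e par w B).
Local Notation active := (@active V e par w B).
Local Notation config := (@config V e o par w B).
Local Notation resolved := (@resolved V e par w B).
Local Notation children := (children par nb).
Local Notation act := (@act V e par w B).
Local Notation newborn := (@newborn V e nb par w B).
Local Notation candidates := (@candidates V e nb par w B).

(* near_opt n stands for configurations that stay nearly optimal for n steps. *)
Variable near_opt : nat -> seq V -> Aut e -> Prop.
Hypothesis near_opt_config : forall n I g, near_opt n I g -> config I g.
Hypothesis near_optW : forall n I g, near_opt n.+1 I g -> near_opt n I g.
Hypothesis near_opt_next : forall n I x g (cf : config I g) (xI : x \notin I) p,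
  par x \in I -> near_opt n.+1 I g -> near_opt n (x :: I) (nextA rootP treeP nbP cf xI p).
Hypothesis near_opt_sum : forall n I x g (cf : config I g) (xI : x \notin I),
  par x \in I -> near_opt n.+1 I g ->
  #|{perm 'I_k.-1}| * size (act I g) <=
    \sum_p size (act (x :: I) (nextA rootP treeP nbP cf xI p)).

Let memA I g v : v \in act I g <-> active I g v := mem_act rootP nbP B w_neq0 I g v.
Let memC I x g g' := mem_candidates rootP nbP B w_neq0 I x g g'.
Let memN I x g g' := mem_newborn rootP nbP B w_neq0 I x g g'.

Lemma near_opt_le m n I g : m <= n -> near_opt n I g -> near_opt m I g.
Proof.
move=> /subnK <-; elim: (n - m) => //= j IH h; exact/IH/near_optW.
Qed.

Definition successor n I x g g' :=
  [/\ cyl I g g', near_opt n (x :: I) g', act (x :: I) g' =i candidates I x g g',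
    uniq (candidates I x g g') & size (act (x :: I) g') = size (candidates I x g g')].

(** Active vertices are candidates, and the average number of candidates is the current number of
    active vertices. By [near_opt_sum] the average of active vertices is no smaller, so the two
    agree for every outcome. *)
Lemma next_successor n I x g (cf : config I g) (xI : x \notin I) p :
  par x \in I -> near_opt n.+1 I g -> successor n I x g (nextA rootP treeP nbP cf xI p).
Proof.
move=> px no; pose nx q := nextA rootP treeP nbP cf xI q.
have nc q : cyl I g (nx q) by exact: next_cyl.
have sub q := act_sub_candidates rootP nbP w_neq0 cf xI px (nc q).
have le q : size (act (x :: I) (nx q)) <= size (candidates I x g (nx q)).
  by apply: uniq_leq_size (sub q); exact: uniq_act.
have szE : size (candidates I x g (nx p)) <= size (act (x :: I) (nx p)).
  rewrite leqNgt; apply/negP => lt.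
  have := near_opt_sum cf xI px no; apply/negP; rewrite -ltnNge.
  rewrite -(sum_candidates rootP treeP nbP k_gt2 cf xI px).
  rewrite (bigD1 p) //= [X in _ < X](bigD1 p) //= -addSn leq_add //.
  by apply: leq_sum => q _; exact: le.
have u := uniq_act par w B (x :: I) (nx p).
have [eqs eqm] := uniq_min_size u (sub p) szE.
split=> //; first exact: near_opt_next.
exact: leq_size_uniq u (sub p) szE.
Qed.

Lemma perm_gt0 : 0 < #|{perm 'I_k.-1}|.
Proof. by apply/card_gt0P; exists 1%g. Qed.

Lemma ex_successor n I x g : near_opt n.+1 I g -> x \notin I -> par x \in I ->
  exists2 g', successor n I x g g' & size (act I g) <= size (act (x :: I) g').
Proof.
move=> no xI px; have cf := near_opt_config no.
pose nx q := nextA rootP treeP nbP cf xI q.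
have [/existsP[p hp]|] := boolP [exists p, size (act I g) <= size (act (x :: I) (nx p))].
  by exists (nx p) => //; exact: next_successor.
move=> /existsPn lt; have := near_opt_sum cf xI px no; rewrite leqNgt => /negP[].
rewrite -sum_nat_const (bigD1 (1%g : {perm 'I_k.-1})) //=.
rewrite [X in _ < X](bigD1 (1%g : {perm 'I_k.-1})) //= -addSn leq_add //.
  by have := lt (1%g : {perm 'I_k.-1}); rewrite -ltnNge.
by apply: leq_sum => q _; have := lt q; rewrite -ltnNge => /ltnW.
Qed.

(** Let [p] fix all children of [v]. If no outcome exceeds the current number, the average forces
    equality everywhere, in particular at [p]. *)
Lemma ex_successor_all n I x g v : near_opt n.+1 I g -> x \notin I -> par x \in I ->
  resolved I x g v ->
  (exists2 g', successor n I x g g' & size (act I g) < size (act (x :: I) g')) \/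
  (exists g', [/\ successor n I x g g', size (act (x :: I) g') = size (act I g) &
     forall c, c \in children v -> wordA g' w c = c]).
Proof.
move=> no xI px rv; have cf := near_opt_config no.
pose nx q := nextA rootP treeP nbP cf xI q.
have [p pall] := next_all_children rootP treeP nbP cf xI px rv.
have sp q := next_successor cf xI q px no.
have [/existsP[q hq]|] := boolP [exists q, size (act I g) < size (act (x :: I) (nx q))].
  by left; exists (nx q).
move=> /existsPn le; right; exists (nx p); split=> //.
apply/eqP; rewrite eqn_leq leqNgt le /= leqNgt; apply/negP => lt.
have := near_opt_sum cf xI px no; rewrite leqNgt => /negP[].
rewrite -sum_nat_const (bigD1 p) //= [X in _ < X](bigD1 p) //= -addSn leq_add //.
by apply: leq_sum => q _; have := le q; rewrite -leqNgt.
Qed.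

(* Reveal the leaves ys of the trajectory D of v.  A vertex that becomes active
   on the way has a leaf outside D, so when only x is left of D, the vertices
   resolved at x belong to S. *)
Lemma explore v x (D S ys : seq V) : x \in D -> x \notin ys -> forall m I g,
  near_opt (size ys + m) I g -> active I g v -> traj g w v = D -> x \notin I ->
  (forall y, y \in D -> [\/ y \in I, y = x | y \in ys]) ->
  (forall u, active I g u -> [\/ u \in S, x \notin traj g w u |
     exists2 y, y \in traj g w u & y \notin I /\ y \notin D]) ->
  (exists I' g', near_opt m I' g' /\ size (act I g) < size (act I' g')) \/
  (exists I' g', [/\ near_opt m I' g', size (act I' g') = size (act I g), active I' g' v,
     traj g' w v = D & x \notin I'] /\
     [/\ {subset D <= x :: I'} & forall u, active I' g' u -> [\/ u \in S, x \notin traj g' w u |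
     exists2 y, y \in traj g' w u & y \notin I' /\ y \notin D]]).
Proof.
move=> xD; elim: ys => [|y ys IH] xys m I g no av tv xI cov inv.
  right; exists I, g; split => //; split=> // y /cov[yI|->|//]; rewrite in_cons ?eqxx ?yI ?orbT //.
move: xys; rewrite in_cons negb_or => /andP[xy xys].
have skip : y \in I \/ y \notin D -> (forall z, z \in D -> [\/ z \in I, z = x | z \in ys]).
  move=> h z zD; have [zI|->|] := cov z zD; [by constructor 1|by constructor 2|].
  rewrite in_cons => /orP[/eqP zy|]; last by constructor 3.
  by case: h => [|/negP[]]; rewrite -zy //; constructor 1.
have [yI|yI] := boolP (y \in I).
  by apply: (IH xys m I g) => //; [exact: near_optW | apply: skip; left].
have [yD|yD] := boolP (y \in D); last first.
  by apply: (IH xys m I g) => //; [exact: near_optW | apply: skip; right].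
have cf := near_opt_config no.
have Dstar : {subset D <= star I} by rewrite -tv; have [] := goods_good av.1.
have py : par y \in I by exact: Dstar.
have [g' [gg' no' actE _ _] le] := ex_successor no yI py.
move: le; rewrite leq_eqVlt => /orP[/eqP eqA|lt]; last first.
  by left; exists (y :: I), g'; split=> //; apply: near_opt_le no'; rewrite leq_addl.
have av' : active (y :: I) g' v.
  apply/memA; rewrite actE; apply/memC; left.
  split=> // -[_ s]; have := s x; rewrite tv => /(_ xD).
  by rewrite in_cons (negPf xI) (negPf xy).
have tv' : traj g' w v = D by rewrite (cyl_traj gg' _).1 // tv.
have xI' : x \notin y :: I by rewrite in_cons negb_or xy.
have cov' z : z \in D -> [\/ z \in y :: I, z = x | z \in ys].
  move=> /cov[zI|->|]; rewrite !in_cons; [by constructor 1; rewrite zI orbT|by constructor 2|].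
  by move=> /orP[->|->]; [constructor 1|constructor 3].
have inv' u : active (y :: I) g' u -> [\/ u \in S, x \notin traj g' w u |
     exists2 z, z \in traj g' w u & z \notin y :: I /\ z \notin D].
  move=> /[dup] au' /memA; rewrite actE => /memC[[au _]|].
    have [s _ _] := goods_good au.1; rewrite (cyl_traj gg' s).1.
    have [uS|xu|[z zu [zI zD]]] := inv u au; [by constructor 1|by constructor 2|].
    constructor 3; exists z; rewrite // in_cons negb_or zI andbT; split=> //.
    by apply: contraNneq zD => ->.
  move=> [uo ru fu]; have ngu := resolved_child_new rootP cf yI gg' uo ru.
  have [gp [i [iw inS ix]]] := goods_new rootP cf yI gg' au'.1 ngu.
  constructor 3; exists (pointA g' w i u); first exact: traj_mem.
  have [s _ _] := goods_good au'.1.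
  have [_ ->] := new_leaf rootP cf yI (s _ (traj_mem g' u iw)) inS; split=> //.
  by apply: contra inS => /Dstar.
have := IH xys m (y :: I) g' no' av' tv' xI' cov' inv'.
by rewrite -eqA.
Qed.

(* Induction on the number of active vertices through x.  If letting all the
   children of v be fixed does not change the number of active vertices, then
   as many vertices are born as are resolved, and a child c2 of v does not go
   through the new leaf p1 of its sibling c1. *)
Lemma growth t : exists n, forall m I g v x, near_opt (n + m) I g -> active I g v ->
  x \in traj g w v -> x \notin I ->
  count (fun u => x \in traj g w u) (act I g) <= t ->
  exists I' g', near_opt m I' g' /\ size (act I g) < size (act I' g').
Proof.
elim: t => [|t [n IH]].
  exists 0 => m I g v x _ av xv xI; rewrite leqn0 -leqn0 leqNgt -has_count => /hasPn/(_ v).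
  by rewrite xv => /(_ (iffRL (memA _ _ _) av)).
(* At most [size w] steps reveal the rest of [D], one reveals [x], and [n] are left for the
   induction. *)
exists (size w + n.+1) => m I g v x no av xv xI le.
set D := traj g w v in xv *.
have [] := @explore v x D [seq u <- act I g | x \in traj g w u] [seq y <- D | y != x] xv _
  (n.+1 + m) I g _ av erefl xI.
- by rewrite mem_filter eqxx.
- apply: near_opt_le no; rewrite -addnA leq_add2r size_filter.
  by apply: leq_trans (count_size _ _) _; rewrite size_map size_iota.
- move=> y yD; have [->|yx] := eqVneq y x; [by constructor 2|constructor 3].
  by rewrite mem_filter yx.
- move=> u au; have [xu|xu] := boolP (x \in traj g w u); [constructor 1|by constructor 2].
  by rewrite mem_filter xu; apply/memA.
- move=> [I' [g' [no' lt]]]; exists I', g'; split=> //.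
  by apply: near_opt_le no'; rewrite leq_addl.
move=> [I' [g' [[no' eqA av' tv' xI'] [DI' inv']]]].
have rv : resolved I' x g' v by split; rewrite // tv'.
have cf := near_opt_config no'.
have sv : {subset D <= star I'} by rewrite -tv'; have [] := goods_good av'.1.
have px : par x \in I' by exact: sv.
rewrite -eqA; have [] := ex_successor_all no' xI' px rv.
  move=> [g'' [_ no'' _ _ _] lt]; exists (x :: I'), g''; split=> //.
  by apply: near_opt_le no''; rewrite leq_addl.
move=> [g'' [[gg'' no'' actE uc szE] eqA'' fixall]].
have vo := active_neq_root cf av'.
have szch : 1 < size (children v).
  by rewrite (size_children rootP nbP vo); case: k k_gt2 => [|[|[]]].
pose c1 := nth o (children v) 0; pose c2 := nth o (children v) 1.
have c1v : c1 \in children v by rewrite mem_nth // (ltn_trans _ szch).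
have c2v : c2 \in children v by rewrite mem_nth.
have c12 : c1 != c2 by rewrite nth_uniq ?(uniq_children _ nbP) // (ltn_trans _ szch).
have newc c : c \in children v -> [/\ c != o, par c = v, c \in newborn I' x g' g'' &
    active (x :: I') g'' c].
  move=> cv; have /(childrenP rootP nbP)[co pc] := cv.
  have cn : c \in newborn I' x g' g''.
    by apply/memN; rewrite pc; split=> //; exact: fixall.
  by split=> //; apply/memA; rewrite actE mem_cat cn orbT.
have [c1o pc1 c1n ac1] := newc _ c1v.
have [c2o pc2 c2n ac2] := newc _ c2v.
have ngc1 : ~ goods I' g' c1.
  by apply: (resolved_child_new rootP cf xI' gg'' c1o); rewrite pc1.
have [_ [i [iw inS ix]]] := goods_new rootP cf xI' gg'' ac1.1 ngc1.
rewrite pc1 in ix; set p1 := pointA g'' w i c1 in inS.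
have p1S : p1 \in star (x :: I').
  by have [s _ _] := goods_good ac1.1; apply/s/traj_mem.
have [pp1 p1N] := new_leaf rootP cf xI' p1S inS.
rewrite -eqA''.
apply: (IH m (x :: I') g'' c1 p1) => //.
  exact: traj_mem.
pose P u := `[<resolved I' x g' u>].
(* The number of active vertices is unchanged, so births balance resolutions. *)
have szn : size (newborn I' x g' g'') = count P (act I' g').
  apply/eqP; rewrite -(eqn_add2r (count (predC P) (act I' g'))) count_predC.
  by rewrite -eqA'' szE size_cat size_filter addnC.
(* By the invariant of [explore], a resolved vertex passed through [x] already at the start, and at
   most [t + 1] did. *)
have leR : count P (act I' g') <= t.+1.
  apply: leq_trans le; rewrite -!size_filter; apply: uniq_leq_size.
    by rewrite filter_uniq ?uniq_act.
  move=> u; rewrite mem_filter => /andP[/asboolP ru /memA au].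
  have xu := resolved_mem ru.
  have [//|/negP//|[y yu [yI yD]]] := inv' u au.
  by have := ru.2 _ yu; rewrite in_cons (negPf yI) orbF => /eqP yx; rewrite yx xv in yD.
(* Vertices through the new leaf [p1] are newborn, since older trajectories lie in the former star;
   leaving out [c2] brings their number down to [t]. *)
rewrite -ltnS; apply: leq_trans leR; rewrite -szn -size_filter.
have c2pos : 0 < size (newborn I' x g' g'') by case: (newborn _ _ _ _) c2n.
rewrite -(prednK c2pos) ltnS -(size_rem c2n); apply: uniq_leq_size.
  by rewrite filter_uniq ?uniq_act.
move=> u; rewrite mem_filter => /andP[pu]; rewrite actE mem_cat => /orP[|un].
  rewrite mem_filter => /andP[_ /memA au].
  have [s _ _] := goods_good au.1; move: pu; rewrite (cyl_traj gg'' s).1 => /s.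
  by rewrite (negPf inS).
(* If [c2] reached [p1] at step [j], then [v] would be at [x] at steps [i] and [j]; its trajectory
   has no repetition, so [i = j] and [c1 = c2]. *)
have uc2 : u != c2.
  apply: contra_neq c12 => uc2; move: pu; rewrite uc2 => /trajP[j jw jp].
  have [_ vE] := goods_pointA gg'' av'.1 jw.
  have [_ vEi] := goods_pointA gg'' av'.1 iw.
  suff ij : i = j by apply: (@aut_inj _ _ (pointA g'' w i)); rewrite -/p1 jp ij.
  apply: (uniq_traj_inj (active_uniq cf av') iw jw); rewrite ix -vE -pp1 [in LHS]jp.
  apply/esym/(pointA_leaf (I := x :: I') rootP) => //; rewrite -?jp //.
    by rewrite -pc2; exact: (adj_par rootP).
  by rewrite vE; apply: star_cons; exact: (goods_pointA gg'' av'.1 jw).1.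
by rewrite mem_rem_uniq ?inE ?uc2 //; move: uc; rewrite cat_uniq => /and3P[].
Qed.

(** With at most [M] active vertices, [growth] applies with [t = M], and increasing their number
    repeatedly contradicts the bound. *)
Lemma near_opt_inactive (M : nat) :
  (forall I g, near_opt 0 I g -> size (act I g) <= M) ->
  exists n, forall I g, near_opt n I g -> forall v, ~ active I g v.
Proof.
move=> bd; have [nM gM] := growth M.
suff H j : exists n, forall m I g, near_opt (n + m) I g -> (exists v, active I g v) ->
    exists I' g', near_opt m I' g' /\ j <= size (act I' g').
  have [n Hn] := H M.+1; exists n => I g no v av.
  have [||I' [g' [no' lt]]] := Hn 0 I g; [by rewrite addn0|by exists v|].
  by have := bd _ _ no'; rewrite leqNgt lt.
elim: j => [|j [n IH]]; first by exists 0 => m I g no _; exists I, g.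
exists (n + nM) => m I g; rewrite -addnA => no ex.
have [I1 [g1 [no1 le1]]] : exists I1 g1, near_opt (nM + m) I1 g1 /\ maxn 1 j <= size (act I1 g1).
  have [I1 [g1 [no1 le1]]] := IH _ _ _ no ex.
  (* For [j = 0] the original configuration is kept, so that an active vertex is at hand for
     [growth]. *)
  case: j {IH} le1 => [_|j le1]; last by exists I1, g1; split; rewrite ?(maxn_idPr _).
  have [v av] := ex; exists I, g; split; first by apply: near_opt_le no; rewrite leq_addl.
  by rewrite -has_predT; apply/hasP; exists v => //; apply/memA.
have [v /memA av] : exists v, v \in act I1 g1.
  have: has predT (act I1 g1) by rewrite has_predT (leq_trans _ le1) // leq_max.
  by move=> /hasP[v]; exists v.
have := av.2 => /existsNP[x /not_implyP[xv /negP xI]].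
have [|I2 [g2 [no2 lt2]]] := gM m I1 g1 v x no1 av xv xI.
  apply: leq_trans (count_size _ _) _; apply: bd.
  by apply: near_opt_le no1.
exists I2, g2; split=> //; apply: leq_trans lt2; rewrite ltnS.
by apply: leq_trans le1; rewrite leq_maxr.
Qed.

End Growth.

(** * Survival has measure zero *)

Section Topology.
Variables (V : choiceType) (e : rel V).
Implicit Types (g h : Aut e) (v : V).

Lemma open_eval g v : open [set h : Aut e | h v = g v].
Proof.
exists [set f : {ptws V -> discrete_topology V} | f v = g v]; last by [].
rewrite (_ : [set f | _] = (fun f : {ptws V -> discrete_topology V} => f v) @^-1` [set g v]) //.
apply: open_comp; last exact: discrete_open.
by move=> + _; exact: proj_continuous.
Qed.

Lemma open_agree g (r : seq V) : open [set h : Aut e | forall v, v \in r -> h v = g v].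
Proof.
elim: r => [|u r IH].
  by rewrite (_ : [set h | _] = setT) ?eqEsubset; [exact: openT | split].
rewrite (_ : [set h | _] = [set h : Aut e | h u = g u] `&` [set h | forall v, v \in r -> h v = g v]).
  exact: openI (open_eval _ _) IH.
apply/seteqP; split=> h /= hr; first by split=> [|v vr]; apply: hr; rewrite in_cons ?eqxx ?vr ?orbT.
by move=> v; rewrite in_cons => /orP[/eqP->|]; [exact: hr.1 | exact: hr.2].
Qed.

End Topology.

Section Measure.
Variables (R : realType) (V : choiceType) (e : rel V) (k : nat) (nb : V -> seq V).
Variable mu : {measure set (BorelAut e) -> \bar R}.
Variables (o : V) (par : V -> V) (dep : V -> nat).
Hypothesis rootP : rooting e o par dep.
Hypothesis treeP : is_tree e.
Hypothesis nbP : neighbours e k nb.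
Hypothesis k_gt2 : 2 < k.
Hypothesis mu_inv : forall (g : Aut e) (A : set (BorelAut e)), measurable A ->
  mu [set (g * h)%g | h in A] = mu A.
Hypothesis mu_stab : forall v, mu (vertex_stabilizer e v) = 1%E.
Variables (w : seq (bool * Aut e)) (B : seq V).
Hypothesis w_neq0 : w != [::].
Implicit Types (g h : Aut e) (v x y z : V) (I : seq V).

Local Notation star := (star par).
Local Notation cyl := (@cyl V e par).
Local Notation active := (@active V e par w B).
Local Notation config := (@config V e o par w B).
Local Notation act := (@act V e par w B).

Lemma open_measurable (A : set (Aut e)) : open A -> measurable (A : set (BorelAut e)).
Proof. exact: sub_sigma_algebra. Qed.

Lemma open_cyl I g : open (cyl I g).
Proof.
have [r rE] := star_finite rootP nbP I.
rewrite (_ : cyl I g = [set h | forall v, v \in r -> h v = g v]); first exact: open_agree.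
by apply/seteqP; split=> h hg v; [rewrite rE|rewrite -rE]; exact: hg.
Qed.

Lemma measurable_cyl I g : measurable (cyl I g : set (BorelAut e)).
Proof. apply: open_measurable; exact: open_cyl. Qed.

Definition survivors : set (Aut e) :=
  [set h | forall I, config I h -> exists v, active I h v].

(** Extinction is witnessed by the values on one star, so the complement is a union of open
    cylinders. *)
Lemma measurable_survivors : measurable (survivors : set (BorelAut e)).
Proof.
rewrite -[survivors]setCK; apply: measurableC; apply: open_measurable.
pose P := [set p : seq V * Aut e | config p.1 p.2 /\ forall v, ~ active p.1 p.2 v].
rewrite (_ : ~` survivors = \bigcup_(p in P) cyl p.1 p.2).
  by apply: bigcup_open => p _; exact: open_cyl.
apply/seteqP; split=> h.
  move=> /existsNP[I /not_implyP[cf nex]]; exists (I, h) => //; split=> // v av.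
  by apply: nex; exists v.
move=> [[I g] [/= cf na] gh] hs; have [v av] := hs I (config_cyl gh cf).
by apply: (na v); exact: active_cyl (cyl_sym gh) av.
Qed.

Lemma mu_cyl_translate I f g : mu (cyl I (f * g)%g) = mu (cyl I g).
Proof.
rewrite -(mu_inv f (measurable_cyl I g)); congr (mu _); apply/seteqP; split=> h.
  move=> hg; exists (f^-1 * h)%g; last by rewrite mulVKg.
  by move=> v vI; rewrite /= hg // autVK.
by move=> [h' h'g <-] v vI; rewrite /= h'g.
Qed.

(** The cylinder lies in the coset by [g] of the stabilizer of [o]; this makes the measures below
    finite. *)
Lemma mu_cyl_le1 I g : o \in I -> (mu (cyl I g) <= 1)%E.
Proof.
move=> oI; rewrite -(mu_stab o).
have mS : measurable (vertex_stabilizer e o : set (BorelAut e)).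
  by apply: open_measurable; exact: (open_eval 1%g o).
rewrite -(mu_inv g mS); apply: le_measure; rewrite ?inE; first exact: measurable_cyl.
  apply: open_measurable.
  rewrite (_ : [set _ | _ in _] = [set h : Aut e | h o = g o]); first exact: open_eval.
  apply/seteqP; split=> h; first by move=> [h' h'o <-] /=; rewrite h'o.
  by move=> /= ho; exists (g^-1 * h)%g; rewrite ?mulVKg //= /vertex_stabilizer /= ho autVK.
move=> h hg; exists (g^-1 * h)%g; rewrite ?mulVKg //= /vertex_stabilizer /= hg ?autVK //.
by rewrite inE (par_root rootP).
Qed.

Lemma mu_cyl_split I x g (cf : config I g) (xI : x \notin I) (A : set (BorelAut e)) :
  par x \in I -> measurable A ->
  mu (A `&` cyl I g) = (\sum_p mu (A `&` cyl (x :: I) (nextA rootP treeP nbP cf xI p)))%E.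
Proof.
move=> px mA; pose nx p := nextA rootP treeP nbP cf xI p.
have -> : A `&` cyl I g = \bigcup_(p in [set: {perm 'I_k.-1}]) (A `&` cyl (x :: I) (nx p)).
  apply/seteqP; split=> h; last first.
    move=> [p _ [Ah ph]]; split=> // v vI; rewrite (cyl_cons ph) //.
    by rewrite (next_cyl rootP treeP nbP cf xI px p).
  by move=> [Ah /(cyl_next rootP treeP nbP cf xI px)[p ph]]; exists p.
rewrite measure_fin_bigcup //.
- rewrite (fsbigE (enum {perm 'I_k.-1})) ?enum_uniq //; last first.
    by move=> p _; rewrite mem_enum.
  by rewrite big_enum_cond /=; apply: eq_bigl => p; rewrite in_setT.
- exact: finite_finset.
- move=> p q _ _ [h [[_ ph] [_ qh]]]; exact: (next_inj px ph qh).
- by move=> p _; apply: measurableI => //; exact: measurable_cyl.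
Qed.

Let m I g : R := fine (mu (cyl I g)).
Let s I g : R := fine (mu (survivors `&` cyl I g)).
Local Open Scope ring_scope.

Lemma mE I g : o \in I -> mu (cyl I g) = (m I g)%:E.
Proof.
move=> oI; rewrite fineK // ge0_fin_numE //.
by apply: le_lt_trans (mu_cyl_le1 g oI) _; rewrite ltry.
Qed.

Lemma measurable_sc I g : measurable (survivors `&` cyl I g : set (BorelAut e)).
Proof. by apply: measurableI; [exact: measurable_survivors|exact: measurable_cyl]. Qed.

Lemma sc_le I g : (mu (survivors `&` cyl I g) <= mu (cyl I g))%E.
Proof.
apply: le_measure; rewrite ?inE; [exact: measurable_sc|exact: measurable_cyl|].
exact: subIsetr.
Qed.

Lemma sE I g : o \in I -> mu (survivors `&` cyl I g) = (s I g)%:E.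
Proof.
move=> oI; rewrite fineK // ge0_fin_numE //.
by apply: le_lt_trans (sc_le I g) _; rewrite mE // ltry.
Qed.

Lemma m_ge0 I g : 0 <= m I g. Proof. exact: fine_ge0. Qed.
Lemma s_ge0 I g : 0 <= s I g. Proof. exact: fine_ge0. Qed.

Lemma s_le_m I g : o \in I -> s I g <= m I g.
Proof. by move=> oI; rewrite -lee_fin -mE // -sE // sc_le. Qed.

Let K : R := #|{perm 'I_k.-1}|%:R.

(** The outcomes are left translates of one another, so they share the measure of [cyl I g]
    equally. *)
Lemma m_split I x g (cf : config I g) (xI : x \notin I) p : par x \in I ->
  m I g = K * m (x :: I) (nextA rootP treeP nbP cf xI p).
Proof.
move=> px; have oI : o \in I by case: cf.
have oxI : o \in x :: I by rewrite in_cons oI orbT.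
have meq q : m (x :: I) (nextA rootP treeP nbP cf xI q) = m (x :: I) g.
  by rewrite /m /nextA mu_cyl_translate.
apply: EFin_inj; rewrite -mE // -[cyl I g]setTI (mu_cyl_split cf xI px) //.
under eq_bigr do rewrite setTI mE // meq.
by rewrite meq sumEFin sumr_const -mulr_natl.
Qed.

Lemma s_split I x g (cf : config I g) (xI : x \notin I) : par x \in I ->
  s I g = \sum_p s (x :: I) (nextA rootP treeP nbP cf xI p).
Proof.
move=> px; have oI : o \in I by case: cf.
have oxI : o \in x :: I by rewrite in_cons oI orbT.
apply: EFin_inj; rewrite -sE // (mu_cyl_split cf xI px); last exact: measurable_survivors.
by under eq_bigr do rewrite sE //; rewrite sumEFin.
Qed.

Lemma s_active I g : config I g -> 0 < s I g -> act I g != [::].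
Proof.
move=> cf; apply: contraTneq => a0; rewrite /s.
rewrite (_ : survivors `&` cyl I g = set0) ?measure0 ?ltxx //.
apply/seteqP; split=> // h [hs gh]; have [v av] := hs I (config_cyl gh cf).
have : v \in act I g by apply/(mem_act rootP nbP B w_neq0)/(active_cyl (cyl_sym gh)).
by rewrite a0.
Qed.

Lemma K_ge1 : 1 <= K. Proof. by rewrite ler1n perm_gt0. Qed.

Lemma sum_act_le I x g (cf : config I g) (xI : x \notin I) : par x \in I ->
  (\sum_p size (act (x :: I) (nextA rootP treeP nbP cf xI p)) <=
    #|{perm 'I_k.-1}| * size (act I g))%N.
Proof.
move=> px; rewrite -(sum_candidates rootP treeP nbP k_gt2 cf xI px).
apply: leq_sum => p _; apply: uniq_leq_size; first exact: uniq_act.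
exact: (act_sub_candidates rootP nbP w_neq0 cf xI px (next_cyl rootP treeP nbP cf xI px p)).
Qed.

Section NearOptimal.
Variable th : R.
Hypothesis th_gt0 : 0 < th.
Hypothesis th_ub : forall I g, config I g -> s I g <= th * (size (act I g))%:R * m I g.

(** The gap between the conditional survival probability and its bound [th * A], weighted by the
    measure of the cylinder so that gaps add up over outcomes. *)
Let defect I g := th * (size (act I g))%:R * m I g - s I g.

(* The factor K ^+ n leaves room for n further steps, each of which may multiply
   the relative defect by K. *)
Definition near_opt n I g :=
  [/\ config I g, 0 < m I g & defect I g * K ^+ n < th * m I g].

Lemma defect_ge0 I g : config I g -> 0 <= defect I g.
Proof. by move=> /th_ub; rewrite subr_ge0. Qed.

Lemma config_next I x g (cf : config I g) (xI : x \notin I) p : par x \in I ->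
  config (x :: I) (nextA rootP treeP nbP cf xI p).
Proof. move=> px; apply: config_cons => //.
exact: (config_cyl (next_cyl rootP treeP nbP cf xI px p) cf). Qed.

Lemma sum_defect I x g (cf : config I g) (xI : x \notin I) p0 : par x \in I ->
  \sum_p defect (x :: I) (nextA rootP treeP nbP cf xI p) =
  th * (\sum_p size (act (x :: I) (nextA rootP treeP nbP cf xI p)))%:R *
    m (x :: I) (nextA rootP treeP nbP cf xI p0) - s I g.
Proof.
move=> px; rewrite sumrB -(s_split cf xI px); congr (_ - _).
rewrite natr_sum mulr_sumr mulr_suml; apply: eq_bigr => p _; congr (_ * _).
have K0 : K != 0 by rewrite gt_eqF // (lt_le_trans _ K_ge1).
by apply: (mulfI K0); rewrite -!m_split.
Qed.

Lemma near_opt_m_next n I x g (cf : config I g) (xI : x \notin I) p : par x \in I ->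
  near_opt n I g -> defect I g * K ^+ n < th * K * m (x :: I) (nextA rootP treeP nbP cf xI p).
Proof. by move=> px [_ _]; rewrite (m_split cf xI p px) mulrA. Qed.

Lemma near_optP_config n I g : near_opt n I g -> config I g. Proof. by case. Qed.

Lemma near_optP_W n I g : near_opt n.+1 I g -> near_opt n I g.
Proof.
move=> [cf m0 lt]; split=> //; apply: le_lt_trans lt.
by rewrite ler_wpM2l ?defect_ge0 // ler_weXn2l ?K_ge1.
Qed.

(** Defects are nonnegative and sum over the outcomes to at most the old one, so each is at most the
    old one, while the measure drops by the factor [K]. *)
Lemma near_optP_next n I x g (cf : config I g) (xI : x \notin I) p : par x \in I ->
  near_opt n.+1 I g -> near_opt n (x :: I) (nextA rootP treeP nbP cf xI p).
Proof.
move=> px no; have K0 := lt_le_trans ltr01 K_ge1.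
have lt := near_opt_m_next cf xI p px no; have [_ m0 _] := no.
split; first exact: config_next.
  by move: m0; rewrite (m_split cf xI p px) pmulr_rgt0.
rewrite -(ltr_pM2l K0); apply: le_lt_trans (_ : _ <= defect I g * K ^+ n.+1) _; last first.
  by rewrite mulrA [K * _]mulrC.
rewrite exprS mulrCA ler_wpM2r ?mulr_ge0 ?exprn_ge0 ?(ltW K0) //.
have : \sum_q defect (x :: I) (nextA rootP treeP nbP cf xI q) <= defect I g.
  rewrite (sum_defect cf xI p px) lerD2r (m_split cf xI p px) mulrA ler_wpM2r ?m_ge0 //.
  by rewrite -mulrA ler_wpM2l ?(ltW th_gt0) // mulrC -natrM ler_nat sum_act_le.
apply: le_trans; rewrite (bigD1 p) //= lerDl sumr_ge0 // => q _.
exact/defect_ge0/config_next.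
Qed.

(** Losing even one active vertex in the sum would lower the total defect by [th * m']; near
    optimality makes the defect smaller than that, and the total would be negative. *)
Lemma near_optP_sum n I x g (cf : config I g) (xI : x \notin I) : par x \in I ->
  near_opt n.+1 I g ->
  (#|{perm 'I_k.-1}| * size (act I g) <=
    \sum_p size (act (x :: I) (nextA rootP treeP nbP cf xI p)))%N.
Proof.
move=> px no; have K0 := lt_le_trans ltr01 K_ge1.
rewrite leqNgt; apply/negP => sum_lt.
pose p0 : {perm 'I_k.-1} := 1%g; pose m' := m (x :: I) (nextA rootP treeP nbP cf xI p0).
have : 0 <= \sum_q defect (x :: I) (nextA rootP treeP nbP cf xI q).
  by apply: sumr_ge0 => q _; exact/defect_ge0/config_next.
rewrite (sum_defect cf xI p0 px) -/m' leNgt => /negP; apply.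
have lt := near_opt_m_next cf xI p0 px no; rewrite -/m' in lt.
have dlt : defect I g < th * m'.
  rewrite -(ltr_pM2l K0) mulrA [K * th]mulrC; apply: le_lt_trans lt.
  rewrite mulrC ler_wpM2l ?defect_ge0 // -{1}[K]expr1 ler_weXn2l ?K_ge1 //.
have := dlt; rewrite /defect (m_split cf xI p0 px) -/m' => {}dlt.
apply: le_lt_trans (_ : _ <= th * (K * (size (act I g))%:R - 1) * m' - s I g) _.
  rewrite lerD2r ler_wpM2r ?m_ge0 // ler_wpM2l ?(ltW th_gt0) //.
  by rewrite lerBrDr natr1 -natrM ler_nat.
by move: dlt; rewrite mulrBr mulrBl mulr1 -subr_lt0; congr (_ < _); ring.
Qed.

End NearOptimal.

Lemma null_survivors I0 g0 : config I0 g0 -> mu (survivors `&` cyl I0 g0) = 0%E.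
Proof.
move=> cf0; have oI0 : o \in I0 by case: cf0.
rewrite sE //; congr (_%:E); apply/eqP; rewrite eq_le s_ge0 andbT leNgt; apply/negP => s0.
pose S := [set r | exists I g, [/\ config I g, 0 < m I g, act I g != [::] &
  r = s I g / ((size (act I g))%:R * m I g)]].
have A_ge1 I g : act I g != [::] -> 1 <= (size (act I g))%:R :> R.
  by rewrite ler1n; case: (act I g).
have supS : has_sup S.
  split.
    exists (s I0 g0 / ((size (act I0 g0))%:R * m I0 g0)), I0, g0; split=> //.
      by apply: lt_le_trans s0 _; exact: s_le_m.
    exact: s_active.
  exists 1 => _ [I [g [cf m0 a0 ->]]]; have A1 := A_ge1 _ _ a0.
  rewrite ler_pdivrMr ?mulr_gt0 ?(lt_le_trans ltr01 A1) // mul1r.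
  apply: le_trans (_ : m I g <= _); first by apply: s_le_m; case: cf.
  by rewrite ler_peMl ?m_ge0.
pose th := sup S.
have th_ge I g : config I g -> 0 < m I g -> act I g != [::] ->
    s I g <= th * (size (act I g))%:R * m I g.
  move=> cf m0 a0; have A1 := A_ge1 _ _ a0.
  rewrite -mulrA -ler_pdivrMr ?mulr_gt0 ?(lt_le_trans ltr01 A1) //.
  by apply: (ub_le_sup supS.2); exists I, g.
have m00 : 0 < m I0 g0 by apply: lt_le_trans s0 _; exact: s_le_m.
have th_gt0 : 0 < th.
  have a0 := s_active cf0 s0; have := lt_le_trans s0 (th_ge _ _ cf0 m00 a0).
  by rewrite -mulrA pmulr_lgt0 // mulr_gt0 // (lt_le_trans ltr01 (A_ge1 _ _ a0)).
have th_ub I g : config I g -> s I g <= th * (size (act I g))%:R * m I g.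
  move=> cf; have oI : o \in I by case: cf.
  have [sp|sn] := ltP 0 (s I g); last first.
    by apply: le_trans sn _; rewrite mulr_ge0 ?m_ge0 // mulr_ge0 ?(ltW th_gt0).
  by apply: th_ge => //; [apply: lt_le_trans sp _; exact: s_le_m | exact: s_active].
(* Near optimality at order 0 gives [th * A * m < th * m + s <= (1 + th) * m], hence
   [A < (1 + th) / th]. *)
have [M HM] : exists M : nat, (1 + th) / th < M%:R.
  by exists (Num.bound ((1 + th) / th)); apply: archi_boundP; rewrite divr_ge0 ?addr_ge0 ?ltW.
have bd I g : near_opt th 0 I g -> (size (act I g) <= M)%N.
  move=> [cf m0]; rewrite expr0 mulr1 ltrBlDr => lt; rewrite -(ler_nat R).
  apply/ltW/(lt_trans _ HM); rewrite ltr_pdivlMr // -(ltr_pM2r m0) mulrDl mul1r.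
  rewrite [_ * th]mulrC; apply: lt_le_trans lt _; rewrite addrC lerD2r.
  by apply: s_le_m; case: cf.
have [n Hn] := near_opt_inactive k_gt2 w_neq0 (@near_optP_config th)
  (@near_optP_W th th_ub) (@near_optP_next th th_gt0 th_ub)
  (@near_optP_sum th th_gt0 th_ub) bd.
have K0 := lt_le_trans ltr01 K_ge1; have Kn0 := exprn_gt0 n K0.
(* For a configuration within the factor [1 - eta] of the supremum, the first bound gives
   [th * A < 2]; the second then makes the defect small enough for [near_opt th n]. *)
pose eta := Num.min (1 / 2) (th / (2 * K ^+ n)).
have eta0 : 0 < eta by rewrite lt_min !divr_gt0 ?mulr_gt0.
have eta1 : eta <= 1 / 2 by rewrite ge_min lexx.
have eta2 : eta * (2 * K ^+ n) <= th.
  by rewrite -ler_pdivlMr ?mulr_gt0 // ge_min lexx orbT.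
have [_ [I [g [cf m0 a0 ->]]]] := sup_adherent (mulr_gt0 th_gt0 eta0) supS.
have A1 := A_ge1 _ _ a0; set A := (size (act I g))%:R in A1 *.
have Am0 : 0 < A * m I g by rewrite mulr_gt0 ?(lt_le_trans ltr01 A1).
rewrite -/th ltr_pdivlMr // => lt.
have sm : s I g <= m I g by apply: s_le_m; case: cf.
have thA : th * A < 2.
  rewrite -(ltr_pM2r m0).
  have : th * A * m I g * (1 - eta) < m I g by apply: lt_le_trans sm; lra.
  have : th * A * m I g * (1 / 2) <= th * A * m I g * (1 - eta).
    by rewrite ler_wpM2l //; [rewrite -mulrA mulr_ge0 ?ltW | lra].
  lra.
have no : near_opt th n I g.
  split=> //; rewrite -/A.
  have d : th * A * m I g - s I g < eta * (th * A) * m I g by lra.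
  apply: lt_le_trans (_ : eta * (th * A) * m I g * K ^+ n <= _); first by rewrite ltr_pM2r.
  rewrite mulrAC ler_pM2r //; apply: le_trans eta2; rewrite -mulrA ler_pM2l //.
  by rewrite ler_pM2r // ltW.
have : has predT (act I g) by rewrite has_predT lt0n size_eq0.
by move=> /hasP[v /(mem_act rootP nbP B w_neq0) av _]; exact: Hn no v av.
Qed.

End Measure.

Lemma negligible_injective_cover d (T : measurableType d) (R : realType)
    (mu : {measure set T -> \bar R}) (J : Type) (D : set J) (c : J -> nat) (F : J -> set T) :
  (forall i j, D i -> D j -> c i = c j -> i = j) ->
  (forall j, D j -> mu.-negligible (F j)) -> mu.-negligible (\bigcup_(j in D) F j).
Proof.
move=> cinj nF; pose G n := \bigcup_(j in [set j | D j /\ c j = n]) F j.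
apply: (@negligibleS _ _ _ _ (\bigcup_n G n)).
  by move=> t [j Dj Fj]; exists (c j) => //; exists j.
apply: negligible_bigcup => n.
have [[j [Dj cj]]|nj] := pselect (exists j, D j /\ c j = n); last first.
  apply: (@negligibleS _ _ _ _ set0); last exact: negligible_set0.
  by move=> t [j cj _]; apply: nj; exists j.
apply: negligibleS (nF j Dj) => t [j' [Dj' cj'] Fj'].
by have -> : j = j' by apply: cinj; rewrite ?cj ?cj'.
Qed.

(** * From infinitely many fixed vertices to survival *)

Section TreeFacts.
Variables (V : choiceType) (e : rel V) (k : nat) (nb : V -> seq V).
Variables (o : V) (par : V -> V) (dep : V -> nat).
Hypothesis rootP : rooting e o par dep.
Hypothesis nbP : neighbours e k nb.

Lemma iter_dep v : iter (dep v) par v = o.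
Proof.
elim/(root_ind rootP): v => [|v vo IH]; first by have [_ -> _ _] := rootP.
by rewrite (dep_par rootP vo) iterSr.
Qed.

(** The vertices of a given depth lie in a finite list; a vertex is encoded by its depth and its
    position there. *)
Lemma countable_vertices : exists c : V -> nat, injective c.
Proof.
pose r n := iter n (fun s => flatten (map nb s)) [:: o].
have rP v : v \in r (dep v).
  elim/(root_ind rootP): v => [|v vo IH]; first by have [_ -> _ _] := rootP; rewrite mem_head.
  rewrite (dep_par rootP vo) /=; apply/flattenP; exists (nb (par v)); first exact: map_f.
  by have [_ _ ->] := nbP (par v); exact: (par_adj rootP).
exists (fun v => choice.pickle (dep v, index v (r (dep v)))) => u v.
move=> /(pcan_inj choice.pickleK)[duv iuv].
by rewrite -(nth_index o (rP u)) iuv duv nth_index.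
Qed.

Lemma down_closure (l : seq V) : exists I : seq V,
  [/\ o \in I, forall v, v \in I -> par v \in I & {subset l <= I}].
Proof.
exists (flatten [seq [seq iter n par v | n <- iota 0 (dep v).+1] | v <- o :: l]).
have inI v n : v \in o :: l -> n <= dep v ->
    iter n par v \in flatten [seq [seq iter n par v | n <- iota 0 (dep v).+1] | v <- o :: l].
  move=> vl le; apply/flattenP; exists [seq iter n par v | n <- iota 0 (dep v).+1].
    exact: (map_f (fun v => [seq iter n par v | n <- iota 0 (dep v).+1])).
  by apply: (map_f (fun n => iter n par v)); rewrite mem_iota ltnS.
have oI := inI o 0 (mem_head _ _) (leq0n _).
split=> //; last by move=> v vl; apply: (inI v 0) => //; rewrite in_cons vl orbT.
move=> x /flattenP[s /mapP[v vl ->] /mapP[n]]; rewrite mem_iota ltnS => /= le ->.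
move: le; rewrite leq_eqVlt => /orP[/eqP->|lt].
  by rewrite iter_dep (par_root rootP).
by rewrite -iterS; exact: inI.
Qed.

(** Were [f (par v)] a child of [f v], the induction hypothesis would give [f (par (par v)) = f v],
    against injectivity. *)
Lemma aut_par (f : Aut e) v : f o = o -> f (par v) = par (f v).
Proof.
move=> fo; elim/(root_ind rootP): v => [|v vo IH]; first by rewrite fo (par_root rootP) fo.
have := adj_par rootP vo; rewrite -(aut_adj f) (rooted_adj rootP) => /andP[_ /orP[/eqP //|/eqP h]].
move: h; rewrite -IH => /(@aut_inj _ _ f) h.
by have := par_par_neq rootP vo; rewrite h eqxx.
Qed.

Lemma infinite_tree : 2 < k -> ~ finite_set [set: V].
Proof.
move=> k2 /finite_seqP[r rE].
have rP v : v \in r by have : [set: V] v by []; rewrite rE.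
have child v : exists u, dep u = (dep v).+1.
  have : has predT (children par nb v).
    rewrite has_predT; have [->|vo] := eqVneq v o; last first.
      by rewrite (size_children rootP nbP vo); case: k k2 => [|[]].
    have [_ sz nbE] := nbP o; rewrite /children (par_root rootP) (eq_in_filter (a2 := predT)).
      by rewrite filter_predT sz; case: k k2.
    by move=> u; rewrite nbE (rooted_adj rootP) eq_sym => /andP[].
  move=> /hasP[u /(childrenP rootP nbP)[uo up] _]; exists u.
  by rewrite (dep_par rootP uo) up.
have lev n : exists v, n <= dep v.
  elim: n => [|n [v le]]; first by exists o.
  by have [u du] := child v; exists u; rewrite du.
have [v] := lev (\sum_(u <- r) dep u).+1.
by rewrite (big_rem v (rP v)) /= ltnNge leq_addr.
Qed.

End TreeFacts.

Section Survivors.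
Variables (V : choiceType) (e : rel V) (k : nat) (nb : V -> seq V).
Variables (o : V) (par : V -> V) (dep : V -> nat).
Hypothesis rootP : rooting e o par dep.
Hypothesis nbP : neighbours e k nb.
Variables (w : seq (bool * Aut e)) (B : seq V).
Hypothesis w_neq0 : w != [::].

(** If some configuration had no active vertex, good vertices would have their trajectories in [I],
    hence their neighbours would have theirs in the star. Descending from [o], all fixed vertices
    would be good, and good vertices are finitely many. *)
Lemma infinite_fix_survivors (h : Aut e) :
  (forall v, wordA h w v = v -> v \in B \/ uniq (traj h w v)) ->
  ~ finite_set [set v | wordA h w v = v] -> survivors o par w B h.
Proof.
move=> uB inf I cf; apply: contrapT => na; apply: inf.
apply: sub_finite_set (finite_goods rootP nbP B w_neq0 I h) => v /=.
have [ oI dI oB fo tB] := cf.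
elim/(root_ind rootP): v => [_|v vo IH fv]; first exact: (root_goods rootP cf).
have fp : wordA h w (par v) = par v by rewrite (aut_par rootP v fo) fv.
have gp := IH fp; apply/goodsS; split=> //; split=> //; last exact: uB.
have sI : {subset traj h w (par v) <= I}.
  by apply: contrapT => ns; apply: na; exists (par v).
move=> _ /trajP[i iw ->]; apply: (nbr_star rootP dI (sI _ (traj_mem h (par v) iw))).
by rewrite aut_adj (par_adj rootP).
Qed.

End Survivors.

Section InfiniteFix.
Variables (R : realType) (V : choiceType) (e : rel V) (k : nat).
Variable mu : {measure set (BorelAut e) -> \bar R}.
Hypothesis treeP : is_tree e.
Hypothesis regP : regular_graph e k.
Hypothesis k_gt2 : 2 < k.
Hypothesis mu_inv : forall (g : Aut e) (A : set (BorelAut e)), measurable A ->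
  mu [set (g * h)%g | h in A] = mu A.
Hypothesis mu_stab : forall v, mu (vertex_stabilizer e v) = 1%E.

Lemma negligible_infinite_fix (w : seq (bool * Aut e)) : w != [::] ->
  mu.-negligible [set h : BorelAut e | finite_set [set v | ~ uniq (traj h w v)] /\
    ~ finite_set [set v | wordA h w v = v]].
Proof.
move=> w0; have [nb nbP] := ex_neighbours regP.
have [ [r0 _] _ _ _] := treeP.
have [par0 [dep0 root0]] := ex_rooting r0 treeP.
have [c cinj] := countable_vertices root0 nbP.
(* The fixed vertex [o] depends on [h], so a rooting is chosen for every vertex at once. *)
have /choice[pd pdP] : forall o, exists pd : (V -> V) * (V -> nat), rooting e o pd.1 pd.2.
  by move=> o; have [par [dep rP]] := ex_rooting o treeP; exists (par, dep).
have /choice[rI rIP] : forall p : V * seq V, exists r : seq V, r =i star (pd p.1).1 p.2.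
  by move=> [ o I]; exact: star_finite (pdP o) nbP I.
(* An index records the root, the exceptional set, the subtree and the values of [h] on its star;
   there are countably many, and each confines [h] to one cylinder. *)
pose J := (V * seq V * (seq V * seq V))%type.
pose F (j : J) : set (BorelAut e) :=
  let o := j.1.1 in let B := j.1.2 in let I := j.2.1 in let par := (pd o).1 in
  survivors o par w B `&` [set h | config o par w B I h /\ map h (rI (o, I)) = j.2.2].
pose code (j : J) := choice.pickle ((c j.1.1, map c j.1.2), (map c j.2.1, map c j.2.2)).
apply: (@negligibleS _ _ _ _ (\bigcup_j F j)); last first.
  apply: (@negligible_injective_cover _ _ _ _ _ _ code) => [[[ o B] [I r]] [[ o' B'] [I' r']] _ _|].
    move=> /(pcan_inj choice.pickleK)[/cinj-> /(inj_map cinj)->].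
    by move=> /(inj_map cinj)-> /(inj_map cinj)->.
  move=> [[ o B] [I r]] _; have [[h0 [/= cf hr]]|nex] := pselect (exists h0,
      config o (pd o).1 w B I h0 /\ map h0 (rI (o, I)) = r); last first.
    apply: (@negligibleS _ _ _ _ set0); last exact: negligible_set0.
    by move=> h [_ /= ?]; apply: nex; exists h.
  pose C : set (BorelAut e) := survivors o (pd o).1 w B `&` cyl (pd o).1 I h0.
  apply: (@negligibleS _ _ _ _ C).
    move=> h [hs [/= cfh hrh]]; split=> // v; rewrite -(rIP (o, I)) => vr.
    by move: hrh; rewrite -hr => /eq_in_map/(_ v vr).
  apply/negligibleP; first exact: measurable_sc (pdP o) nbP _ _ _ _.
  by apply: (null_survivors (pdP o) treeP nbP k_gt2 mu_inv mu_stab w0 cf).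
move=> h [/finite_seqP[B0 B0E] inf].
have [ o fo] : exists o, wordA h w o = o.
  apply: contrapT => nex; apply: inf; rewrite (_ : [set v | _] = set0) //.
  by apply/seteqP; split=> // v fv; apply: nex; exists v.
pose B := o :: B0.
have [I [ oI dI sI]] := down_closure (pdP o) (flatten [seq traj h w u | u <- B]).
exists ((o, B), (I, map h (rI (o, I)))) => //; split=> /=.
  apply: (infinite_fix_survivors (pdP o) nbP w0) => // v _.
  have [?|nu] := boolP (uniq (traj h w v)); [by right|left].
  have : [set v | ~ uniq (traj h w v)] v by apply/negP.
  by rewrite B0E /= in_cons => ->; rewrite orbT.
split=> //; split=> //; first exact: mem_head.
by move=> u uB x xu; apply: sI; apply/flattenP; exists (traj h w u) => //; exact: map_f.
Qed.

End InfiniteFix.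

(** * Reduced words *)

Section Reduced.
Variables (V : choiceType) (e : rel V).
Variable Gamma : groupClosed (Aut e).
Implicit Types (g h a : Aut e) (w : seq (bool * Aut e)).

(** Rules out exactly [t t^-1] and [t^-1 t]: the sign may change only across a nontrivial
    automorphism. *)
Definition reduced w :=
  sorted (fun l l' : bool * Aut e => (l.2 == 1%g) ==> (l.1 == l'.1)) w.

Definition letters_in w := all (fun l : bool * Aut e => l.2 \in Gamma) w.

(* Up to conjugation by a this is multiplication by a on the left. *)
Lemma reduced_mulr w a : w != [::] -> reduced w -> letters_in w -> a \in Gamma ->
  exists w', [/\ w' != [::], size w' = size w, reduced w', letters_in w' &
    forall g, wordA g w' = (wordA g w * a)%g].
Proof.
case/lastP: w => // w [b a'] _ rw; rewrite /letters_in all_rcons => /andP[/= a'G wG] aG.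
exists (rcons w (b, (a' * a)%g)); split=> //; first by case: (w).
- by rewrite !size_rcons.
- move: rw; rewrite /reduced; case: w {wG} => //= l w; rewrite !rcons_path => /andP[-> /=].
  by case: (last l w).
- by rewrite /letters_in all_rcons /= wG gpredM.
- by move=> g; rewrite -!cats1 !wordA_cat /= /lettA /= !mulg1 !mulgA.
Qed.

(** A repetition at steps [i < j] cuts out a shorter word that fixes [X v], where [X] is
    injective. *)
Lemma nonuniq_traj_finite g w : acts_almost_freely Gamma -> reduced w -> letters_in w ->
  (forall u, u != [::] -> size u < size w -> reduced u -> letters_in u ->
    finite_set [set v | wordA g u v = v]) ->
  finite_set [set v | ~ uniq (traj g w v)].
Proof.
move=> free rw wG fin.
pose D := [set p : 'I_(size w) * 'I_(size w) | p.1 < p.2].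
pose E (p : 'I_(size w) * 'I_(size w)) := [set v | pointA g w p.1 v = pointA g w p.2 v].
apply: (@sub_finite_set _ _ (\bigcup_(p in D) E p)).
  move=> v /negP/(uniqPn v)[i [j [ij]]]; rewrite size_map size_iota => jw.
  have iw := ltn_trans ij jw.
  rewrite !(nth_map 0) ?size_iota // !nth_iota // !add0n => eij.
  by exists (Ordinal iw, Ordinal jw).
apply: bigcup_finite => [|[i j]]; first exact: finite_finset.
rewrite /D /E /=; move: (ltn_ord i) (ltn_ord j).
move: (nat_of_ord i) (nat_of_ord j) => {}i {}j iw jw ij.
have [w1 [l [w2 [l' [w3 [wE s1 s2]]]]]] : exists w1 l w2 l' w3,
    [/\ w = w1 ++ l :: w2 ++ l' :: w3, size w1 = i & size w1 + (size w2).+1 = j].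
  have x0 := (true, 1%g : Aut e).
  exists (take i w), (nth x0 w i), (take (j - i.+1) (drop i.+1 w)), (nth x0 w j), (drop j.+1 w).
  have s1 : size (take i w) = i by rewrite size_take iw.
  have s2 : size (take (j - i.+1) (drop i.+1 w)) = j - i.+1.
    by rewrite size_takel // size_drop leq_sub2r // ltnW.
  split=> //; last by rewrite s1 s2 -subSn // subSS subnKC // ltnW.
  have -> : nth x0 w j :: drop j.+1 w = drop (j - i.+1) (drop i.+1 w).
    by rewrite drop_drop subnK // -drop_nth.
  by rewrite cat_take_drop -drop_nth // cat_take_drop.
have pj : pointA g w j = (domA g l' * wordA g w3)%g.
  by rewrite wE -s2 pointA_cat /= -[size w2]addn0 pointA_cat.
have pi : pointA g w i = (domA g l * (wordA g w2 * (lettA g l' * wordA g w3)))%g.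
  by rewrite wE -s1 -[size w1]addn0 pointA_cat /= wordA_cat.
have szw : (size w2).+1 < size w.
  rewrite wE size_cat /= size_cat /=; apply: leq_trans (leq_addl _ _).
  by rewrite !ltnS addnS ltnS leq_addr.
have [rw2 w2G lG] : [/\ reduced (l :: w2 ++ [:: l']), letters_in w2 & l.2 \in Gamma].
  move: rw wG; rewrite wE /reduced /letters_in all_cat /= all_cat => rw /and4P[_ -> -> _]; split=> //.
  have sp : l :: w2 ++ l' :: w3 = (l :: w2 ++ [:: l']) ++ w3 by rewrite /= -catA.
  by move/cat_sorted2: rw => [_]; rewrite sp => /cat_sorted2[].
have l2G : letters_in (l :: w2) by rewrite /letters_in /= lG.
pose X := (lettA g l' * wordA g w3)%g.
(* Equal signs: [l :: w2] fixes [X v]. *)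
have [bb|bb] := eqVneq l.1 l'.1.
  have fx : finite_set [set x | wordA g (l :: w2) x = x].
    apply: fin => //; move: rw2; rewrite -cat_cons => /cat_sorted2[]//.
  apply: sub_finite_set (finite_preimage (f := X) _ fx); last by move=> ? ? _ _; exact: aut_inj.
  move=> v /=; rewrite pi pj /X /lettA /domA bb /=.
  by case: (l'.1) => /= [->|].
(* Opposite signs: the powers of [t] at the two ends drop out and [l.2 * wordA g w2] fixes [X v].
   When [w2] is empty, reducedness makes [l.2] nontrivial. *)
have fx : finite_set [set x | (l.2 * wordA g w2)%g x = x].
  have [w20|w20] := eqVneq w2 [::].
    rewrite w20 /=; apply: free => //; apply: contra bb => /eqP l1.
    by move: rw2; rewrite w20 /= l1 eqxx andbT.
  have rw2' : reduced w2 by move: rw2 => /path_sorted/cat_sorted2[].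
  have [u [u0 su ru uG uE]] := reduced_mulr w20 rw2' w2G lG.
  have fu : finite_set [set x | wordA g u x = x].
    by apply: fin => //; rewrite su; apply: ltn_trans szw.
  apply: sub_finite_set (finite_preimage (f := (l.2^-1)%g : Aut e) _ fu) => [x /= fx|].
    rewrite uE /= autKV; apply: (@aut_inj _ _ l.2); by rewrite autKV.
  by move=> ? ? _ _; exact: aut_inj.
apply: sub_finite_set (finite_preimage (f := X) _ fx); last by move=> ? ? _ _; exact: aut_inj.
move=> v /=; rewrite pi pj /X /lettA /domA.
case: (l.1) (l'.1) bb => [] [] //= _ h.
by apply: (@aut_inj _ _ (g^-1)%g); rewrite h autVK.
Qed.

End Reduced.

Section AlmostEvery.
Variables (R : realType) (V : choiceType) (e : rel V) (k : nat).
Variable mu : {measure set (BorelAut e) -> \bar R}.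
Variable Gamma : groupClosed (Aut e).
Hypothesis treeP : is_tree e.
Hypothesis regP : regular_graph e k.
Hypothesis k_gt2 : 2 < k.
Hypothesis mu_inv : forall (g : Aut e) (A : set (BorelAut e)), measurable A ->
  mu [set (g * h)%g | h in A] = mu A.
Hypothesis mu_stab : forall v, mu (vertex_stabilizer e v) = 1%E.
Hypothesis countG : countable [set` Gamma].
Hypothesis freeG : acts_almost_freely Gamma.

Definition finite_fixes (g : Aut e) (n : nat) := forall w, w != [::] -> size w < n ->
  reduced w -> letters_in Gamma w -> finite_set [set v | wordA g w v = v].

(** Once the shorter words are settled, [nonuniq_traj_finite] makes [negligible_infinite_fix]
    applicable to words of length [n]; as [Gamma] is countable, there are countably many of them. *)
Lemma negligible_finite_fixes n :
  mu.-negligible [set g : BorelAut e | ~ finite_fixes g n].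
Proof.
elim: n => [|n IH].
  by apply: (@negligibleS _ _ _ _ set0); [move=> g h; apply: h | exact: negligible_set0].
have /countable_injP[f finj] := countG.
pose bad w : set (BorelAut e) := [set h | finite_set [set v | ~ uniq (traj h w v)] /\
    ~ finite_set [set v | wordA h w v = v]].
pose D := [set w : seq (bool * Aut e) | w != [::] /\ letters_in Gamma w].
pose c (w : seq (bool * Aut e)) := choice.pickle [seq (l.1, f l.2) | l <- w].
have nbad : mu.-negligible (\bigcup_(w in D) bad w).
  apply: (@negligible_injective_cover _ _ _ _ _ _ c) => [w w' [_ wG] [_ w'G]|w [w0 _]].
    move=> /(pcan_inj choice.pickleK); elim: w w' wG w'G => [|[b a] w IHw] [|[b' a'] w'] //=.
    move=> /andP[/= aG wG] /andP[/= a'G w'G] [-> faa /(IHw _ wG w'G)->].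
    by rewrite (finj a a') ?inE.
  exact: (negligible_infinite_fix treeP regP k_gt2 mu_inv mu_stab w0).
apply: negligibleS (negligibleU IH nbad) => g /= nfin.
have [fin|] := pselect (finite_fixes g n); [right|by left].
apply: contrapT => nb; apply: nfin => w w0; rewrite ltnS leq_eqVlt => /orP[/eqP sw|]; last first.
  exact: fin.
move=> rw wG; apply: contrapT => ninf; apply: nb; exists w; split=> //.
by apply: nonuniq_traj_finite rw wG _ => // u u0 su; apply: fin; rewrite // -sw.
Qed.

Lemma ae_finite_fixes : {ae mu, forall g : Aut e, forall n, finite_fixes g n}.
Proof.
apply: negligibleS (negligible_bigcup negligible_finite_fixes) => g /= /existsNP[n nfin].
by exists n.
Qed.

End AlmostEvery.

(** * The free product *)

Section IntPowers.
Variables (G : groupType) (x : G).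
Local Open Scope group_scope.

Definition expgz (n : int) : G := match n with Posz m => x ^+ m | Negz m => (x ^+ m.+1)^-1 end.

Lemma expgzN m : expgz (- (m%:Z))%R = (x ^+ m)^-1.
Proof. by case: m => [|m] /=; rewrite ?expg0 ?invg1. Qed.

Lemma expgz_succ n : expgz (n + 1)%R = expgz n * x.
Proof.
elim/int_ind: n => [|m _|m _].
- by rewrite add0r /= expg1 expg0 mul1g.
- by rewrite -PoszD addn1 /= expgSr.
- rewrite [in RHS]expgzN -addn1 PoszD opprD addrNK expgzN.
  by rewrite addn1 expgS invgM mulgVK.
Qed.

Lemma expgzD m n : expgz (m + n)%R = expgz m * expgz n.
Proof.
have pred p : expgz (p - 1)%R = expgz p * x^-1 by rewrite -{2}(subrK 1%R p) expgz_succ mulgK.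
elim/int_ind: n => [|n IH|n IH]; first by rewrite addr0 /= expg0 mulg1.
  by rewrite -addn1 PoszD addrA !expgz_succ IH mulgA.
by rewrite -addn1 PoszD opprD addrA !pred IH mulgA.
Qed.

End IntPowers.

Section FreeProductAction.
Variables (V : choiceType) (e : rel V).
Variables (Gamma : groupClosed (Aut e)) (g : Aut e).
Local Open Scope group_scope.

Local Notation Gt := (subgroup_type Gamma).
Local Notation Zt := (GRing.to_multiplicative int).
Implicit Types (u : fword Gt Zt) (w : seq (bool * Gt)).

Definition gval (a : Gt) : Aut e := val a.
Arguments gval : simpl never.

Lemma gval1 : gval 1 = 1. Proof. exact: val1. Qed.

Lemma gvalM a b : gval (a * b) = gval a * gval b. Proof. exact: valM. Qed.

Lemma gval_inj : injective gval. Proof. exact: val_inj. Qed.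

Lemma gvalP a : gval a \in Gamma. Proof. exact: (valP a). Qed.

Definition letter_eval (l : Gt + Zt) : Aut e :=
  match l with inl a => gval a | inr n => expgz g n end.

Definition fword_eval u : Aut e := foldr (fun l x => letter_eval l * x) 1 u.

Lemma fword_eval_cat u u' : fword_eval (u ++ u') = fword_eval u * fword_eval u'.
Proof. by elim: u => [|l u IH] /=; rewrite ?mul1g // IH mulgA. Qed.

Lemma fword_eval_eq u u' : fword_eq u u' -> fword_eval u = fword_eval u'.
Proof.
elim=> //=.
- by move=> u1 u2 u3 _ -> _ ->.
- by move=> u1 u2 u3 u4 _ h1 _ h2; rewrite !fword_eval_cat h1 h2.
- by rewrite mulg1 gval1.
- by rewrite expg0 mulg1.
- by move=> a b; rewrite !mulg1 -gvalM.
- by move=> a b; rewrite !mulg1 -expgzD.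
Qed.

Definition sign_int (b : bool) : Zt := if b then 1%R : int else (- 1)%R : int.

Definition letters w : fword Gt Zt := flatten [seq [:: inr (sign_int l.1); inl l.2] | l <- w].

Definition word_of w : seq (bool * Aut e) := [seq (l.1, gval l.2) | l <- w].

Lemma letters_eval w : fword_eval (letters w) = wordA g (word_of w).
Proof.
elim: w => [//|[b a] w IH]; rewrite [LHS]/= -/(letters w) IH /= mulgA; congr (_ * _).
by case: b; rewrite /lettA /= expg1.
Qed.

Lemma letters_in_word_of w : letters_in Gamma (word_of w).
Proof. by elim: w => //= -[b a] w ->; rewrite andbT; exact: gvalP. Qed.

(** Each letter of [w] begins with [t] or [t^-1], so a leading element of [Gamma] is recorded
    separately. *)
Definition normal u := exists a w, reduced (word_of w) /\ fword_eq u (inl a :: letters w).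

Lemma fword_eq_cons l u u' : fword_eq u u' -> fword_eq (l :: u) (l :: u').
Proof. by move=> uu'; apply: (@fword_cat _ _ [:: l] [:: l]) => //; exact: fword_refl. Qed.

Lemma fword_eq_catr u u' v : fword_eq u u' -> fword_eq (u ++ v) (u' ++ v).
Proof. by move=> uu'; apply: fword_cat => //; exact: fword_refl. Qed.

Lemma normal_eq u u' : fword_eq u u' -> normal u' -> normal u.
Proof. by move=> uu' [a [w [rw h]]]; exists a, w; split=> //; exact: fword_trans h. Qed.

(** Prepending [t] or [t^-1] to [a w] keeps the word reduced unless [a = 1] and the signs are
    opposite; then the first letter of [w] cancels. *)
Lemma normal_cons_sign b u : normal u -> normal (inr (sign_int b) :: u).
Proof.
move=> [a [w [rw h]]]; apply: normal_eq (fword_eq_cons _ h) _.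
case: w rw {h} => [|[b' a'] w] rw.
  exists 1, [:: (b, a)]; split=> //=.
  by apply: (fword_sym (fword_eq_catr [:: inr (sign_int b); inl a] (fword_1l _ _))).
have [/andP[/eqP a1 bb']|nab] := boolP ((a == 1) && (b != b')); last first.
  exists 1, [:: (b, a), (b', a') & w]; split.
    rewrite /reduced /= in rw *; rewrite rw andbT; apply/implyP => /eqP va.
    have a1 : a = 1 by apply: gval_inj; rewrite va gval1.
    by move: nab; rewrite a1 eqxx /= negbK.
  exact: (fword_sym (fword_eq_catr (inr (sign_int b) :: inl a :: _) (fword_1l _ _))).
exists a', w; split; first exact: path_sorted rw.
rewrite a1 /= -/(letters w).
apply: fword_trans (fword_eq_cons _ (fword_eq_catr (_ :: _) (fword_1l _ _))) _ => /=.
apply: fword_trans (fword_eq_catr (inl a' :: letters w) (fword_Mr _ _ _)) _ => /=.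
have -> : sign_int b * sign_int b' = 1 by case: (b) (b') bb' => [] [].
exact: (fword_eq_catr (inl a' :: letters w) (fword_1r _ _)).
Qed.

Lemma normal_cons_int (n : int) u : normal u -> normal (inr (n : Zt) :: u).
Proof.
move=> nu; elim/int_ind: n => [|n IH|n IH].
- exact: normal_eq (fword_eq_catr u (fword_1r _ _)) nu.
- apply: normal_eq (normal_cons_sign true IH).
  exact: (fword_sym (fword_eq_catr u (@fword_Mr Gt Zt (sign_int true) n%:Z))).
- apply: normal_eq (normal_cons_sign false IH).
  have := fword_sym (fword_eq_catr u (@fword_Mr Gt Zt (sign_int false) (- n%:Z)%R)).
  by rewrite (_ : sign_int false * _ = (- n.+1%:Z)%R :> int) // -add1n PoszD opprD.
Qed.

Lemma normal_form u : normal u.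
Proof.
elim: u => [|[a|n] u IH]; last exact: normal_cons_int.
  by exists 1, [::]; split=> //; exact/fword_sym/fword_1l.
have [b [w [rw h]]] := IH; exists (a * b), w; split=> //.
apply: fword_trans (fword_eq_cons _ h) _.
exact: (fword_eq_catr (letters w) (fword_Ml _ _ _)).
Qed.

(** A subgroup containing the generators, hence the whole generated group: membership thus yields a
    word. *)
Definition fword_image : {pred Aut e} := fun x => `[< exists u, fword_eval u = x >].

Lemma fword_imageM : mulg_closed fword_image.
Proof.
move=> x y /asboolP[u ux] /asboolP[v vy]; apply/asboolP; exists (u ++ v).
by rewrite fword_eval_cat ux vy.
Qed.

Lemma fword_image1 : 1 \in fword_image.
Proof. by apply/asboolP; exists [::]. Qed.

Lemma fword_imageV : invg_closed fword_image.
Proof.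
move=> x /asboolP[u ux]; apply/asboolP; exists (fword_inv u).
apply: (mulgI x); rewrite mulgV -ux -fword_eval_cat.
by rewrite (fword_eval_eq (fword_mulV u)).
Qed.

HB.instance Definition _ := isMulClosed.Build (Aut e) fword_image fword_imageM.
HB.instance Definition _ := isMul1Closed.Build (Aut e) fword_image fword_image1.
HB.instance Definition _ := isInvClosed.Build (Aut e) fword_image fword_imageV.

Local Notation D := (generated ([set` Gamma] `|` [set g])).

Lemma generated_fword x : x \in D -> exists u, fword_eval u = x.
Proof.
move=> /asboolP/(_ fword_image) h; apply/asboolP/h => y [yG|->].
  by apply/asboolP; exists [:: inl (Sub y yG)]; rewrite /= mulg1 /gval SubK.
by apply/asboolP; exists [:: inr (1%R : int)]; rewrite /= mulg1 expg1.
Qed.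

Lemma fword_eval_generated u : fword_eval u \in D.
Proof.
have gD : g \in D by apply/asboolP => E; apply; right.
elim: u => [|[a|n] u IH] /=; first exact: gpred1.
  rewrite gpredM //; apply/asboolP => E; apply; left; exact: gvalP.
by rewrite gpredM //; case: n => n /=; rewrite ?gpredV gpredXn.
Qed.

Hypothesis infV : ~ finite_set [set: V].
Hypothesis freeG : acts_almost_freely Gamma.
Hypothesis finG : forall n, finite_fixes Gamma g n.

(** Conjugation by [a] turns [a w] into [w a], again given by a reduced word. *)
Lemma normal_fixes a w : w != [::] -> reduced (word_of w) ->
  finite_set [set v | (gval a * wordA g (word_of w)) v = v].
Proof.
move=> w0 rw; have w0' : word_of w != [::] by case: (w) w0.
have [w' [w'0 _ rw' w'G w'E]] := reduced_mulr w0' rw (letters_in_word_of w) (gvalP a).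
have fw := finG w'0 (ltnSn _) rw' w'G.
pose b : Aut e := (gval a)^-1.
have inj : {in b @^-1` [set v | wordA g w' v = v] &, injective b}.
  by move=> ? ? _ _; exact: aut_inj.
apply: sub_finite_set (finite_preimage inj fw) => v /= fv.
by rewrite w'E /= /b autKV -[in RHS]fv autVK.
Qed.

Lemma generated_almost_freely : acts_almost_freely D.
Proof.
move=> x /generated_fword[u <-]; have [a [w [rw h]]] := normal_form u.
rewrite (fword_eval_eq h) /= letters_eval; have [->|w0] := eqVneq w [::].
  by rewrite /= mulg1; apply: freeG; exact: gvalP.
by move=> _; exact: normal_fixes.
Qed.

(** A normal form with a letter has finitely many fixed vertices, whereas the identity fixes the
    whole infinite tree. *)
Lemma fword_eval_ker u : fword_eval u = 1 -> fword_eq u [::].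
Proof.
have [a [w [rw h]]] := normal_form u.
rewrite (fword_eval_eq h) /= letters_eval => a1; apply: fword_trans h _.
have [w0|w0] := eqVneq w [::]; last first.
  case: infV; apply: sub_finite_set (normal_fixes a w0 rw) => v _ /=.
  by have := congr1 (fun f : Aut e => f v) a1.
move: a1; rewrite w0 /= mulg1 => va.
have -> : a = 1 by apply: gval_inj; rewrite va gval1.
exact: fword_1l.
Qed.

Lemma fword_eval_inj u u' : fword_eval u = fword_eval u' -> fword_eq u u'.
Proof.
move=> uu'; have : fword_eval (u ++ fword_inv u') = 1.
  by rewrite fword_eval_cat uu' -fword_eval_cat (fword_eval_eq (fword_mulV u')).
move=> /fword_eval_ker h.
apply: fword_trans (_ : fword_eq ((u ++ fword_inv u') ++ u') _); last exact: fword_eq_catr u' h.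
rewrite -catA -[X in fword_eq X]cats0; apply: fword_cat; first exact: fword_refl.
by apply: fword_sym; have := fword_mulV (fword_inv u'); rewrite fword_invK.
Qed.

Lemma generated_isomorphic : isomorphic (subgroup_type D) (free_product Gt Zt).
Proof.
have /choice[U UE] (x : subgroup_type D) := generated_fword (valP x).
pose f x : free_product Gt Zt := (\pi_(free_product Gt Zt) (U x))%qT.
pose f' (q : free_product Gt Zt) : subgroup_type D :=
  exist (fun x => x \in D) _ (fword_eval_generated (repr q)).
exists f; split.
  exists f' => [x|q].
    by apply: val_inj; rewrite /= (fword_eval_eq (fword_repr (U x))) UE.
  rewrite -[RHS]reprK; apply/fp_piP/fword_eval_inj.
  by rewrite UE.
move=> x y; rewrite /f [RHS]fp_mul_pi; apply/fp_piP/fword_eval_inj.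
by rewrite fword_eval_cat !UE valM.
Qed.

End FreeProductAction.

Local Close Scope nat_scope.

Theorem mainTheorem1 (R : realType) (k : nat) (V : choiceType) (e : rel V)
  (mu : {measure set (BorelAut e) -> \bar R}) (Gamma : groupClosed (Aut e)) :
  (3 <= k)%N -> is_tree e -> regular_graph e k ->
  haar_measure mu -> (forall v : V, mu (vertex_stabilizer e v) = 1%E) ->
  countable [set` Gamma] -> acts_almost_freely Gamma ->
  {ae mu, forall gamma : Aut e,
    let D := generated ([set` Gamma] `|` [set gamma]) in
    acts_almost_freely D /\
    isomorphic (subgroup_type D)
      (free_product (subgroup_type Gamma) (GRing.to_multiplicative int))}.
Proof.
move=> k3 treeP regP [_ _ mu_inv] mu_stab countG freeG.
have infV : ~ finite_set [set: V].
  have [nb nbP] := ex_neighbours regP; have [ [r0 _] _ _ _] := treeP.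
  by have [par [dep rootP]] := ex_rooting r0 treeP; exact: (infinite_tree rootP nbP k3).
apply: negligibleS (ae_finite_fixes treeP regP k3 mu_inv mu_stab countG freeG).
move=> g /= nconcl fin; apply: nconcl; split.
  exact: generated_almost_freely freeG fin.
exact: generated_isomorphic infV fin.
Qed.
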